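(* Let $K$ be a field, let $G$ be a connected simple graph on the vertex set $[n]=\{1,\dots,n\}$ with $m$ edges, and let $R_G=S/P_G$, where $S=K[x_{ij}:1\le i,j\le n]$ and $P_G$ is the ideal of $S$ generated by the binomials $x_{ii}x_{jj}-x_{ij}x_{ji}$ with $\{i,j\}$ an edge of $G$, $i<j$. Then $$2m-1\le \operatorname{rank}\operatorname{Cl}(R_G)\le 2^m-1.$$ Moreover, $\operatorname{rank}\operatorname{Cl}(R_G)=2m-1$ if and only if $G$ is the line graph, and $\operatorname{rank}\operatorname{Cl}(R_G)=2^m-1$ if and only if $G$ is the star graph.
   Context: $S$ is the polynomial ring over $K$ in the $n^2$ variables $x_{ij}$, $1\le i,j\le n$. The ring $R_G$ is a normal Noetherian domain, and $\operatorname{Cl}(R_G)$ denotes its divisor class group, which is a free abelian group of finite rank. ''The line graph'' here means the path with $m$ edges, i.e. (up to isomorphism) the graph on $m+1$ vertices with edges $\{1,2\},\{2,3\},\dots,\{m,m+1\}$. ''The star graph'' means (up to isomorphism) the graph on $m+1$ vertices with edges $\{1,2\},\{1,3\},\dots,\{1,m+1\}$. *)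

(* Defs.v *)
From HB Require Import structures.
From mathcomp Require Import freeg mpoly.
From mathcomp Require Import all_boot all_order all_algebra ring_quotient.
From mathcomp Require Import boolp.

Set Implicit Arguments.
Unset Strict Implicit.
Unset Printing Implicit Defensive.

Import GRing.Theory.
Local Open Scope ring_scope.

Section Ideals.
Variable R : comNzRingType.
Implicit Types (A : R -> Prop) (p q : pred R).

Definition ideal_gen A (x : R) : Prop :=
  exists2 s : seq (R * R), {in s, forall c, A c.2} &
    x = \sum_(c <- s) c.1 * c.2.

Fixpoint ideal_pow p (k : nat) : R -> Prop :=
  if k is k'.+1 then
    ideal_gen (fun x => exists a b, [/\ a \in p, ideal_pow p k' b & x = a * b])
  else fun=> True.

Definition prime_ideal p : Prop := idealr_closed p /\ prime_idealr_closed p.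

Definition ideal_proper q p : Prop :=
  {subset q <= p} /\ ~ {subset p <= q}.

Definition height_one p : Prop :=
  [/\ prime_ideal p,
      exists2 q, prime_ideal q & ideal_proper q p &
      ~ exists q0 q1, [/\ prime_ideal q0, prime_ideal q1,
                          ideal_proper q0 q1 & ideal_proper q1 p]].

(* [local_pow p k a] says that the image of [a] in the localization R_p lies
   in (p R_p)^k, with denominators cleared. When R_p is a discrete valuation
   ring, [ord_at p a k] says that the valuation of [a] is k. *)
Definition local_pow p (k : nat) (a : R) : Prop :=
  exists2 s, s \notin p & ideal_pow p k (s * a).

Definition ord_at p (a : R) (k : nat) : Prop :=
  local_pow p k a /\ ~ local_pow p k.+1 a.

End Ideals.

(* The definitions of divisors and of the class group are meant for a normal
   Noetherian domain R, where every localization at a height one prime is a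
   discrete valuation ring and every nonzero a : R has a divisor. *)

Definition height_one_prime (R : comNzRingType) : Type :=
  {p : pred R | `[< height_one p >]}.
HB.instance Definition _ (R : comNzRingType) :=
  Choice.on (height_one_prime R).

Definition Weil_divisor (R : comNzRingType) : zmodType :=
  {freeg (height_one_prime R) / int}.

Section ClassGroup.
Variable R : comNzRingType.

Definition divisor_of (a : R) (D : Weil_divisor R) : Prop :=
  forall p : height_one_prime R,
    exists2 k : nat, coeff p D = k%:Z & ord_at (val p) a k.

(* The subgroup generated by the divisors of the nonzero elements of R. As
   div (a / b) = div a - div b, it consists of the divisors of the nonzero
   elements of the fraction field of R. *)
Definition principal (D : Weil_divisor R) : bool :=
  `[< exists2 s : seq (int * Weil_divisor R),
        {in s, forall c, exists2 a : R, a != 0 & divisor_of a c.2} &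
        D = \sum_(c <- s) c.2 *~ c.1 >].

Fact principal_zmod_closed : zmod_closed principal.
Proof.
split=> [|D E /asboolP[s sP ->] /asboolP[t tP ->]]; apply/asboolP.
  by exists [::]; rewrite ?big_nil.
exists (s ++ [seq (- c.1, c.2) | c <- t]).
  move=> c; rewrite mem_cat => /orP[/sP //|/mapP[d /tP + ->]].
  by [].
rewrite big_cat big_map /= -sumrN; congr (_ + _).
by apply: eq_bigr => c _; rewrite mulrNz.
Qed.

HB.instance Definition _ :=
  GRing.isZmodClosed.Build (Weil_divisor R) principal principal_zmod_closed.

Definition Cl : zmodType := {ideal_quot GRing.ZmodClosed.clone _ principal _}.

End ClassGroup.

Definition Z_independent (A : zmodType) (k : nat) (x : 'I_k -> A) : Prop :=
  forall c : 'I_k -> int, \sum_i x i *~ c i = 0 -> forall i, c i = 0.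

Definition has_rank (A : zmodType) (r : nat) : Prop :=
  (exists x : 'I_r -> A, Z_independent x) /\
  (forall k (x : 'I_k -> A), Z_independent x -> (k <= r)%N).

Definition simple_graph n (e : rel 'I_n) : Prop :=
  symmetric e /\ irreflexive e.

Definition num_edges n (e : rel 'I_n) : nat :=
  #|[set ij : 'I_n * 'I_n | (ij.1 < ij.2)%N && e ij.1 ij.2]|.

Definition connected_graph n (e : rel 'I_n) : Prop :=
  (0 < n)%N /\ forall x y, connect e x y.

Definition graph_iso n n' (e : rel 'I_n) (e' : rel 'I_n') : Prop :=
  exists2 f : 'I_n -> 'I_n', bijective f & forall x y, e' (f x) (f y) = e x y.

Definition line_graph m : rel 'I_m.+1 :=
  fun x y => (x.+1 == y :> nat) || (y.+1 == x :> nat).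

Definition star_graph m : rel 'I_m.+1 :=
  fun x y => (x != y) && ((x == ord0) || (y == ord0)).

Arguments line_graph m : clear implicits.
Arguments star_graph m : clear implicits.

Section GraphRing.
Variables (K : fieldType) (n : nat) (e : rel 'I_n).

(* [mxvec_index] is the bijection from pairs of indices to 'I_(n * n) *)
Definition xvar (i j : 'I_n) : {mpoly K[n * n]} := 'X_(mxvec_index i j).

Definition edge_binomial (f : {mpoly K[n * n]}) : Prop :=
  exists i j : 'I_n, [/\ (i < j)%N, e i j &
    f = xvar i i * xvar j j - xvar i j * xvar j i].

Definition P_G (f : {mpoly K[n * n]}) : bool :=
  `[< ideal_gen edge_binomial f >].

Fact P_G_idealr_closed : idealr_closed P_G.
Proof.
split.
- by apply/asboolP; exists [::]; rewrite ?big_nil.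
- apply/asboolP => -[s sP /(congr1 (meval (fun=> 0 : K)))].
  rewrite meval1 raddf_sum big_seq big1 => [/eqP|c /sP[i [j [_ _ ->]]]] /=.
    by rewrite oner_eq0.
  by rewrite mevalM mevalB !mevalM !mevalXU !mulr0 subrr mulr0.
- move=> a u v /asboolP[s sP ->] /asboolP[t tP ->]; apply/asboolP.
  exists ([seq (a * c.1, c.2) | c <- s] ++ t).
    by move=> c; rewrite mem_cat => /orP[/mapP[d /sP + ->]|/tP].
  rewrite big_cat big_map mulr_sumr /=; congr (_ + _).
  by apply: eq_bigr => c _; rewrite mulrA.
Qed.

HB.instance Definition _ :=
  isIdealr.Build {mpoly K[n * n]} P_G P_G_idealr_closed.

Definition R_G : comNzRingType := {ideal_quot Idealr.clone _ P_G _}.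

End GraphRing.

(* Main.v *)
(* For a vertex v and a set A of neighbours of v, take a variable y_(v,A), and
   for every ordered pair of distinct nonadjacent vertices i, j a variable y_ij.
   Sending x_ii to the product of the y_(i,A), x_ij (for an edge) to the product
   of the y_(i,A) with j in A and of the y_(j,A) with i not in A, and the other
   x_ij to y_ij, embeds R_G in the polynomial ring C in these variables, as the
   subring of elements of degree zero for a grading of C by Z^r. Here r is the
   number of the y_(v,A), which is the sum of the 2^(deg v), minus n + m.
   The ring C is factorial, and homogeneous elements have homogeneous factors.
   Every degree is attained by monomials avoiding a prescribed variable; hence
   g |-> gC cap R_G is a bijection from the homogeneous primes of C, up to
   units, to the height one primes of R_G, under which orders are
   multiplicities. A divisor is principal if and only if the product of the
   corresponding powers of homogeneous primes has degree zero, so that Cl (R_G)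
   is Z^r.
   The inequality 2d <= 2^d (with equality for d = 1, 2), the degree sum formula
   and n <= m + 1 give the lower bound. For the upper bound, r - m counts the
   sets of at least two edges with a common vertex. *)

From HB Require Import structures.
From mathcomp Require Import freeg mpoly.
Require Import Defs.
From mathcomp Require Import all_boot all_order all_algebra.
From mathcomp Require Import ring_quotient perm boolp zify.

Set Implicit Arguments.
Unset Strict Implicit.
Unset Printing Implicit Defensive.

Import Order.TTheory GRing.Theory Num.Theory.
Local Open Scope ring_scope.

(** * Unique factorization in polynomial rings *)

(** A prime of R_G containing x_vv contains x_vw or x_wv for each neighbour w of v, because x_vv
    x_ww = x_vw x_wv. The variable y_(v,A) records one such choice: among the x_ij, it divides the
    images of x_vv, of x_vw for w in A and of x_wv for the other neighbours w, and no others. Hence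
    2^(deg v) variables at v. The grading is built so that degree zero means being an image of
    elements of R_G: the exponents of the y_(v,A) in such a monomial are governed by one integer for
    each vertex and one for each edge, which is where n + m comes from. The y_ij have degree zero.
    Height one primes of R_G need not be principal, whereas the homogeneous primes of C that lie
    over them are. The way back from C to R_G multiplies a homogeneous element by a monomial of
    opposite degree. To keep orders along a given g unchanged, g must not divide this monomial; this
    is why every degree has to be attained without any one prescribed variable. *)

Section Factoriality.
Variable A : idomainType.
Implicit Types a b c p : A.

Definition divides a b := exists c, b = c * a.

Definition prime_elt p :=
  [/\ p != 0, p \isn't a GRing.unit &
      forall a b, divides p (a * b) -> divides p a \/ divides p b].

Definition prime_seq (s : seq A) := {in s, forall p, prime_elt p}.

(** Only the existence of a factorization is required: the factors being prime, and not merely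
    irreducible, uniqueness follows. *)
Definition factorial :=
  forall a, a != 0 ->
    exists u s, [/\ u \is a GRing.unit, prime_seq s & a = u * \prod_(p <- s) p].

Lemma dividesD p a b : divides p a -> divides p b -> divides p (a + b).
Proof. by move=> [c ->] [d ->]; exists (c + d); rewrite mulrDl. Qed.

Lemma dividesN p a : divides p a -> divides p (- a).
Proof. by move=> [c ->]; exists (- c); rewrite mulNr. Qed.

Lemma dividesMl p a b : divides p b -> divides p (a * b).
Proof. by move=> [c ->]; exists (a * c); rewrite mulrA. Qed.

Lemma dividesMr p a b : divides p a -> divides p (a * b).
Proof. by rewrite mulrC; exact: dividesMl. Qed.

Lemma divides0 p : divides p 0.
Proof. by exists 0; rewrite mul0r. Qed.

Lemma divides_trans a b c : divides a b -> divides b c -> divides a c.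
Proof. by move=> [x ->] [y ->]; exists (y * x); rewrite mulrA. Qed.

Lemma divides_unit p u :
  u \is a GRing.unit -> divides p u -> p \is a GRing.unit.
Proof. by move=> + [c defu]; rewrite defu unitrM => /andP[]. Qed.

Lemma prime_seq_cons p s : prime_elt p -> prime_seq s -> prime_seq (p :: s).
Proof. by move=> pP sP q; rewrite inE => /orP[/eqP->|/sP]. Qed.

Lemma prime_seq_cat s t : prime_seq s -> prime_seq t -> prime_seq (s ++ t).
Proof. by move=> sP tP q; rewrite mem_cat => /orP[/sP|/tP]. Qed.

Lemma prime_divides_prod p u s :
  prime_elt p -> u \is a GRing.unit -> divides p (u * \prod_(q <- s) q) ->
  exists2 q, q \in s & divides p q.
Proof.
move=> [_ pNu pP] uU.
elim: s => [|q s IHs].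
  by rewrite big_nil mulr1 => /(divides_unit uU); rewrite (negPf pNu).
rewrite big_cons mulrCA => /pP[pq|/IHs[r rs pr]].
  by exists q; rewrite ?mem_head.
by exists r; rewrite // inE rs orbT.
Qed.

Lemma prime_divides_prime p q :
  prime_elt p -> prime_elt q -> divides p q -> divides q p.
Proof.
move=> [p0 pNu _] [q0 _ qP] [c qE].
have [|[d cE]|//] := qP c p; first by exists 1; rewrite mul1r.
case/negP: pNu; suff : d * p \is a GRing.unit by rewrite unitrM => /andP[].
suff -> : d * p = 1 by rewrite unitr1.
by apply: (mulIf q0); rewrite mul1r {2}qE cE -!mulrA (mulrC p).
Qed.

Lemma divides_prime_associate p q : prime_elt p -> prime_elt q ->
  divides p q -> exists2 u, u \is a GRing.unit & q = u * p.
Proof.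
move=> pP qP pq; have [d pE] := prime_divides_prime pP qP pq.
case: pq => c qE; exists c => //.
have : c * d \is a GRing.unit.
  suff -> : c * d = 1 by rewrite unitr1.
  have [q0 _ _] := qP; apply: (mulIf q0).
  by rewrite mul1r -mulrA -pE.
by rewrite unitrM => /andP[].
Qed.

Lemma prime_factor a : factorial -> a != 0 -> a \isn't a GRing.unit ->
  exists2 p, prime_elt p & divides p a.
Proof.
move=> facA a0 aNu; have [u [[|p s] [uU sP aE]]] := facA a a0.
  by case/negP: aNu; rewrite aE big_nil mulr1.
exists p; first by apply: sP; rewrite mem_head.
by exists (u * \prod_(q <- s) q); rewrite aE big_cons mulrCA mulrC.
Qed.

End Factoriality.

(** * Passing from A to A[X]: Gauss's lemma and primitive polynomials *)

Section PolynomialFactoriality.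
Variable A : idomainType.
Implicit Types (a c p : A) (f g h : {poly A}).

Lemma divides_polyC p f : divides p%:P f <-> forall i, divides p f`_i.
Proof.
split=> [[g ->] i|pf]; first by exists g`_i; rewrite coefMC.
exists (\poly_(i < size f) sval (cid (pf i))).
apply/polyP => i; rewrite coefMC coef_poly; case: ltnP => [_|/leq_sizeP->//].
  by case: cid.
by rewrite mul0r.
Qed.

(** Induction on the sum of the sizes: [p] divides the product of the leading coefficients, hence
    one of them, and the corresponding leading term can be removed from its factor. *)
Lemma divides_polyC_lead p f g :
  prime_elt p -> divides p%:P (f * g) -> divides p%:P f \/ divides p%:P g.
Proof.
move=> [p0 _ pP].
have [k] := ubnP (size f + size g); elim: k => // k IHk in f g *.
have drop f1 g1 : divides p (lead_coef f1) -> (size f1 + size g1 < k.+1)%N ->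
    divides p%:P (f1 * g1) -> divides p%:P f1 \/ divides p%:P g1.
  move=> plf lek pfg; have [->|f0] := eqVneq f1 0.
    by left; exact: divides0.
  pose f2 := f1 - (lead_coef f1)%:P * 'X^((size f1).-1).
  have pl : divides p%:P ((lead_coef f1)%:P * 'X^((size f1).-1)).
    by case: plf => c ->; exists (c%:P * 'X^((size f1).-1));
      rewrite polyCM mulrAC.
  have f2_lt : (size f2 < size f1)%N.
    rewrite -[X in (_ < X)%N]prednK ?size_poly_gt0 // ltnS.
    apply/leq_sizeP => j; rewrite coefB coefCM coefXn leq_eqVlt =>
      /orP[/eqP<-|lt_j].
      by rewrite eqxx mulr1 subrr.
    rewrite (gtn_eqF lt_j) mulr0 subr0 nth_default //.
    by rewrite -[size f1]prednK ?size_poly_gt0.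
  have [||pf2|] := IHk f2 g1; last by right.
  - by rewrite -ltnS (leq_trans _ lek) // ltnS -addSn leq_add2r.
  - rewrite mulrBl; apply: dividesD => //; apply: dividesN.
    exact: dividesMr.
  by left; rewrite -[f1](subrK ((lead_coef f1)%:P * 'X^((size f1).-1)));
    apply: dividesD.
move=> lek pfg; have : divides p (lead_coef f * lead_coef g).
  by rewrite -lead_coefM; have /divides_polyC := pfg; apply.
case/pP=> [plf|plg]; first exact: drop.
by apply/or_comm/drop; rewrite // 1?addnC // mulrC.
Qed.

Lemma prime_polyC p : prime_elt p -> prime_elt p%:P.
Proof.
move=> pP; have [p0 pNu _] := pP; split=> [||f g].
- by rewrite polyC_eq0.
- by rewrite poly_unitE size_polyC p0 /= coefC.
- exact: divides_polyC_lead.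
Qed.

Lemma polyC_unit (u : A) : u \is a GRing.unit -> u%:P \is a GRing.unit.
Proof. by move=> uU; rewrite rmorph_unit. Qed.

Hypothesis facA : factorial A.

(* Cancelling, one after the other, the prime factors of the constant. *)
Lemma factor_scaled c f g h : c != 0 -> c%:P * f = g * h ->
  exists c1 c2 g1 h1,
    [/\ c1 != 0, c2 != 0, g = c1%:P * g1, h = c2%:P * h1 & f = g1 * h1].
Proof.
move=> /facA[u [s [uU sP ->]]]; elim: s => [|p s IHs] in sP g h *.
  rewrite big_nil mulr1 => uf.
  have u0 : u != 0 by apply: contraTneq uU => ->; rewrite unitr0.
  exists u, 1, (u^-1%:P * g), h; rewrite u0 oner_neq0 mul1r.
  rewrite mulrA -polyCM divrr // mul1r -mulrA -uf mulrA -polyCM mulVr //.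
  by rewrite mul1r.
rewrite big_cons mulrCA polyCM -mulrA => pf.
have pP : prime_elt p by apply: sP; rewrite mem_head.
have [p0 _ _] := pP; have pC0 : p%:P != 0 by rewrite polyC_eq0.
have {}sP : prime_seq s by move=> q qs; apply: sP; rewrite inE qs orbT.
have [|[g' gE]|[h' hE]] := divides_polyC_lead (f := g) (g := h) pP.
- by rewrite -pf; exists ((u * \prod_(q <- s) q)%:P * f); rewrite mulrC.
- have [|c1 [c2 [g1 [h1 [c10 c20 g'E hE fE]]]]] := IHs sP g' h.
    by apply: (mulfI pC0); rewrite pf gE mulrA (mulrC g').
  exists (p * c1), c2, g1, h1; split=> //; first exact: mulf_neq0.
  by rewrite polyCM -mulrA mulrC gE g'E.
- have [|c1 [c2 [g1 [h1 [c10 c20 gE h'E fE]]]]] := IHs sP g h'.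
    by apply: (mulfI pC0); rewrite pf hE [RHS]mulrCA (mulrC h').
  exists c1, (p * c2), g1, h1; split=> //; first exact: mulf_neq0.
  by rewrite polyCM -mulrA mulrC hE h'E.
Qed.

Section Irreducible.
Variable f : {poly A}.
Hypothesis f_gt1 : (1 < size f)%N.
Hypothesis f_irr : forall g h, f = g * h ->
  g \is a GRing.unit \/ h \is a GRing.unit.

Let size_unit (u : {poly A}) : u \is a GRing.unit -> size u = 1%N.
Proof. by rewrite poly_unitE => /andP[/eqP]. Qed.

(** Divisibility over the field of fractions descends. Distributing [c] over the two factors splits
    a constant off [f]; it is a unit, since [f] is irreducible and not constant. *)
Lemma irreducible_divides_scaled c g q :
  c != 0 -> c%:P * g = q * f -> divides f g.
Proof.
move=> c0 /(factor_scaled c0)[c1 [c2 [q1 [f1 [_ c20 _ fE ->]]]]].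
have [cU|/size_unit f11] := f_irr fE; last first.
  by move: f_gt1; rewrite fE size_Cmul // f11.
exists (q1 * (c2%:P)^-1); rewrite -mulrA; congr (_ * _).
by rewrite fE mulKr.
Qed.

(* With [d] the gcd of [f] and [g] over the field of fractions, [f] either
   divides [g] up to a constant or is coprime to it. *)
Lemma irreducible_prime : prime_elt f.
Proof.
have f0 : f != 0 by rewrite -size_poly_gt0 ltnW.
split=> // [|g h [q ghE]].
  by rewrite poly_unitE gtn_eqF.
pose d := Pdiv.Idomain.gcdp f g.
have := Pdiv.Idomain.dvdp_gcdl f g; rewrite -/d.
move=> /Pdiv.WeakIdomain.dvdpP[[c d'] /= c0]; rewrite -mul_polyC.
move=> /(factor_scaled c0)[c1 [c2 [d1 [d2 [c10 c20 _ dE fE]]]]].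
have [/size_unit d1_1|/size_unit d2_1] := f_irr fE; [left|right].
  have df : d %= f.
    rewrite -dvdp_size_eqp ?Pdiv.Idomain.dvdp_gcdl //.
    have /eqP/size_poly1P[e e0 d1E] := d1_1.
    by rewrite -/d dE fE d1E !size_Cmul.
  have : f %| g by rewrite -(Pdiv.Idomain.eqp_dvdl _ df) Pdiv.Idomain.dvdp_gcdr.
  move=> /Pdiv.WeakIdomain.dvdpP[[b q1] /= b0]; rewrite -mul_polyC.
  exact: irreducible_divides_scaled.
have cop : Pdiv.Idomain.coprimep f g.
  by rewrite Pdiv.Idomain.coprimep_def -/d dE size_Cmul // d2_1.
have : f %| h.
  rewrite -(Pdiv.Idomain.Gauss_dvdpr _ cop) ghE.
  exact: Pdiv.Idomain.dvdp_mulIr.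
move=> /Pdiv.WeakIdomain.dvdpP[[b q1] /= b0]; rewrite -mul_polyC.
exact: irreducible_divides_scaled.
Qed.

End Irreducible.

(** A prime constant that divides [f] divides its leading coefficient, so only the prime factors of
    the latter are tested, one after the other. In the induction [s] holds those still to be tested
    and [t] those known not to divide; the latter survive a division of [f] by another prime. *)
Lemma primitive_part f : f != 0 -> exists c g,
  [/\ c != 0, f = c%:P * g & forall p, prime_elt p -> ~ divides p%:P g].
Proof.
move=> f0.
suff : exists c g u t,
   [/\ c != 0, f = c%:P * g, u \is a GRing.unit &
       lead_coef g = u * \prod_(p <- t) p /\
       {in t, forall p, prime_elt p /\ ~ divides p%:P g}].
  move=> [c [g [u [t [c0 fE uU [gE tP]]]]]]; exists c, g; split=> // p pP pg.
  have [|q qt pq] := prime_divides_prod (u := u) (s := t) pP uU.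
    by rewrite -gE; have /divides_polyC := pg; apply.
  have [qP []] := tP _ qt.
  apply: divides_trans pg.
  by have [d ->] := prime_divides_prime pP qP pq; exists d%:P; rewrite polyCM.
have [|u [s [uU sP fE]]] := facA (a := lead_coef f);
  first by rewrite lead_coef_eq0.
have : exists t, lead_coef f = u * \prod_(p <- s) p * \prod_(p <- t) p /\
    {in t, forall p, prime_elt p /\ ~ divides p%:P f}.
  by exists [::]; rewrite big_nil mulr1.
elim: s => [|p s IHs] in f f0 {fE} sP *.
  rewrite big_nil mulr1 => -[t [fE tP]]; exists 1, f, u, t.
  by rewrite oner_eq0 mul1r.
have pP : prime_elt p by apply: sP; rewrite mem_head.
have {}sP : prime_seq s by move=> q qs; apply: sP; rewrite inE qs orbT.
rewrite big_cons => -[t [fE tP]].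
have [pf|pf] := pselect (divides p%:P f); last first.
  apply: IHs => //; exists (p :: t); split.
    by rewrite fE big_cons mulrCA [RHS]mulrCA -!mulrA.
  by move=> q; rewrite inE => /orP[/eqP->|/tP].
have [p0 _ _] := pP; have [g gE] := pf.
have g0 : g != 0 by apply: contraNneq f0 => g0; rewrite gE g0 mul0r.
have [] := IHs g g0 sP; first exists t.
  split; first apply: (mulfI p0).
    by rewrite mulrC -{1}(lead_coefC p) -lead_coefM -gE fE (mulrCA u) !mulrA.
  move=> q /tP[qP Nqf]; split=> // qg; apply: Nqf.
  by rewrite gE; apply: dividesMr.
move=> c [h [v [t' [c0 hE vU hP]]]]; exists (p * c), h, v, t'; split=> //.
  exact: mulf_neq0.
by rewrite gE hE polyCM mulrC mulrA.
Qed.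

Lemma prime_seq_polyC s : prime_seq s -> prime_seq [seq c%:P | c <- s].
Proof. by move=> sP q /mapP[c /sP cP ->]; apply: prime_polyC. Qed.

Lemma factorial_polyC c : c != 0 -> exists u s,
  [/\ u \is a GRing.unit, prime_seq s &
      c%:P = u * \prod_(p <- s) p :> {poly A}].
Proof.
move=> /facA[u [s [uU sP cE]]]; exists u%:P, [seq c%:P | c <- s].
split; [exact: polyC_unit | exact: prime_seq_polyC |].
by rewrite big_map -rmorph_prod -polyCM cE.
Qed.

(** Induction on the size. A nonconstant [f] that is not a product of two smaller polynomials is a
    constant times a primitive [g]. A constant factor of [g] has no prime factor, hence is a unit;
    so [g] is irreducible, and therefore prime. *)
Lemma factorial_poly : factorial {poly A}.
Proof.
move=> f; have [k] := ubnP (size f); elim: k => // k IHk in f *.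
move=> lek f0; have [f1|f_gt1] := leqP (size f) 1%N.
  have /size_poly1P[c c0 ->] : size f == 1%N by rewrite eqn_leq f1
    size_poly_gt0.
  exact: factorial_polyC.
have [[g [h [fE gk hk]]]|fC] := pselect (exists g h,
    [/\ f = g * h, (size g < size f)%N & (size h < size f)%N]).
  have [g0 h0] : g != 0 /\ h != 0 by apply/andP; rewrite -negb_or -mulf_eq0 -fE.
  have [||u [s [uU sP gE]]] := IHk g => //; first exact: leq_trans gk _.
  have [||v [t [vU tP hE]]] := IHk h => //; first exact: leq_trans hk _.
  exists (u * v), (s ++ t); split; first by rewrite unitrM uU.
    exact: prime_seq_cat.
  by rewrite big_cat /= mulrACA -gE -hE.
have [c [g [c0 fE gP]]] := primitive_part f0.
have gf : size g = size f by rewrite fE size_Cmul.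
have const_unit q r : g = q * r -> (size q <= 1)%N -> q \is a GRing.unit.
  move=> gE /size1_polyC qE; move: gE; rewrite qE; set d := q`_0 => gE.
  have d0 : d != 0.
    apply: contraNneq f0 => d0; rewrite fE gE d0 mul0r mulr0 //.
  have [dU|dNu] := boolP (d \is a GRing.unit); first exact: polyC_unit.
  have [p pP [e dE]] := prime_factor facA d0 dNu.
  by case: (gP p pP); exists (e%:P * r); rewrite gE dE polyCM mulrAC.
have g_prime : prime_elt g.
  apply: irreducible_prime; first by rewrite gf.
  move=> q r gE; have [q1|q1] := leqP (size q) 1%N; first by left;
    apply: const_unit gE q1.
  have [r1|r1] := leqP (size r) 1%N.
    by right; apply: const_unit r1; rewrite gE mulrC.
  case: fC; exists (c%:P * q), r; rewrite -mulrA -gE size_Cmul // -gf gE.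
  have q0 : q != 0 by rewrite -size_poly_gt0 ltnW.
  have r0 : r != 0 by rewrite -size_poly_gt0 ltnW.
  by rewrite size_mul //; split; [rewrite -gE | lia | lia].
have [u [s [uU sP cE]]] := factorial_polyC c0.
exists u, (g :: s); split=> //; first exact: prime_seq_cons.
by rewrite big_cons mulrCA -cE mulrC fE.
Qed.
End PolynomialFactoriality.

(** Only [f] is assumed to be a morphism; identities about its inverse [g] are checked after
    applying the injective [f]. *)
Lemma factorial_transport (A B : idomainType) (f : {rmorphism B -> A})
    (g : A -> B) : cancel f g -> cancel g f -> factorial A -> factorial B.
Proof.
move=> fK gK facA b b0; have f_inj := can_inj fK.
have fU c : (f c \is a GRing.unit) = (c \is a GRing.unit).
  apply/idP/idP => [|cU]; last exact: rmorph_unit.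
  move=> /unitrPr[d fcd]; apply/unitrPr; exists (g d); apply: f_inj.
  by rewrite rmorphM gK fcd rmorph1.
have fdvd c d : divides (f c) (f d) -> divides c d.
  move=> [e fdE]; exists (g e); apply: f_inj.
  by rewrite rmorphM gK fdE.
have [|u [s [uU sP fbE]]] := facA (f b); first by rewrite raddf_eq0.
exists (g u), [seq g p | p <- s]; split.
- by rewrite -fU gK.
- move=> q /mapP[p /sP[p0 pNu pP] ->]; split=> [||x y [c xyE]].
  + by rewrite -(inj_eq f_inj) gK rmorph0.
  + by rewrite -fU gK.
  have : divides p (f x * f y).
    by exists (f c); rewrite -rmorphM xyE rmorphM gK.
  by case/pP => [] pd; [left|right]; apply: fdvd; rewrite gK.
apply: f_inj; rewrite rmorphM rmorph_prod gK big_map fbE.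
by congr (_ * _); apply: eq_bigr => p _; rewrite gK.
Qed.

(** * Several variables: splitting off the last variable with [muni] *)

Section MpolyFactoriality.

Local Notation widen := (widen_ord (leqnSn _)).

Definition mrestr n (m : 'X_{1..n.+1}) : 'X_{1..n} :=
  [multinom m (widen i) | i < n].

Definition mextend n (m : 'X_{1..n}) (k : nat) : 'X_{1..n.+1} :=
  [multinom if unlift ord_max i is Some j then m j else k | i < n.+1].

Lemma mextend_max n (m : 'X_{1..n}) k : mextend m k ord_max = k.
Proof. by rewrite mnmE unlift_none. Qed.

Lemma widen_lift n (i : 'I_n) : widen i = lift ord_max i.
Proof. by apply: val_inj; rewrite /= /bump leqNgt ltn_ord. Qed.

Lemma mextendK n (m : 'X_{1..n}) k : mrestr (mextend m k) = m.
Proof. by apply/mnmP => i; rewrite !mnmE widen_lift liftK. Qed.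

Lemma mrestrK n (m : 'X_{1..n.+1}) : mextend (mrestr m) (m ord_max) = m.
Proof.
apply/mnmP => i; rewrite mnmE; case: unliftP => [j|] -> //.
by rewrite mnmE widen_lift.
Qed.

Variable K : fieldType.

Lemma muniX n (m : 'X_{1..n.+1}) :
  muni 'X_[K, m] = 'X_[mrestr m] *: 'X^(m ord_max).
Proof. by rewrite muniE msuppX big_seq1 mcoeffX eqxx scale1r. Qed.

Lemma coef_muni n (p : {mpoly K[n.+1]}) (m : 'X_{1..n.+1}) :
  ((muni p)`_(m ord_max))@_(mrestr m) = p@_m.
Proof.
rewrite [in RHS](mpolyE p) muniE coef_sum !raddf_sum /=.
apply: eq_bigr => m' _.
rewrite coefZ coefXn -scalerAl !mcoeffZ mcoeffX; congr (_ * _).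
case: (eqVneq m' m) => [->|neq_m]; first by rewrite eqxx mulr1 mcoeffX eqxx.
case: (eqVneq (m ord_max) _) => [eq_max|_]; last by rewrite mulr0 mcoeff0.
rewrite mulr1 mcoeffX; case: eqP => // eq_restr; case/eqP: neq_m.
by rewrite -[m']mrestrK -[m]mrestrK eq_max [mrestr m']eq_restr.
Qed.

(** A right inverse of [muni]. As [muni] is injective, it is a two-sided inverse, which is all that
    [factorial_transport] asks for. *)
Definition poly_mpoly n (q : {poly {mpoly K[n]}}) : {mpoly K[n.+1]} :=
  \sum_(i < size q) \sum_(m <- msupp q`_i) q`_i@_m *: 'X_[mextend m i].

Lemma poly_mpolyK n : cancel (@poly_mpoly n) (@muni n K).
Proof.
move=> q; rewrite /poly_mpoly raddf_sum /= -[RHS]coefK poly_def.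
apply: eq_bigr => i _; rewrite raddf_sum /= [in RHS](mpolyE q`_i) scaler_suml.
apply: eq_bigr => m _.
by rewrite muniZ muniX mextendK mextend_max scalerA mul_mpolyC.
Qed.

Lemma muni_inj n : injective (@muni n K).
Proof.
by move=> p q eq_pq; apply/mpolyP => m; rewrite -!coef_muni eq_pq.
Qed.

Lemma factorial_mpoly n : factorial {mpoly K[n]}.
Proof.
elim: n => [|n IHn].
  have KU : factorial K.
    move=> a a0; exists a, [::]; rewrite unitfE a0 big_nil mulr1.
    by split.
  exact: (factorial_transport (f := mcoeff 0%MM) (@mpolyKC _) (@mpolyCK 0 K)).
apply: (factorial_transport (f := @muni n K)) (@poly_mpolyK n) (factorial_poly
  IHn).
exact: inj_can_sym (@poly_mpolyK n) (@muni_inj n).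
Qed.

End MpolyFactoriality.

(** * Weighted homogeneous polynomials *)

Section TopWeight.
Variables (K : fieldType) (n : nat) (w : 'X_{1..n} -> int).
Hypothesis wD : forall a b : 'X_{1..n}, w (a + b)%MM = w a + w b.
Implicit Types (f g h : {mpoly K[n]}).

Lemma seq_argmax (T : eqType) (v : T -> int) (s : seq T) : s != [::] ->
  exists2 x, x \in s & {in s, forall y, v y <= v x}.
Proof.
elim: s => // x s IHs _; case: (eqVneq s [::]) => [->|/IHs[y ys yP]].
  by exists x; rewrite ?mem_head // => y; rewrite inE => /eqP->.
case: (lerP (v y) (v x)) => vxy; [exists x | exists y].
- by rewrite mem_head.
- by move=> z; rewrite inE => /orP[/eqP->//|/yP/le_trans]; apply.
- by rewrite inE ys orbT.
- by move=> z; rewrite inE => /orP[/eqP->|/yP//]; apply: ltW.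
Qed.

Lemma msupp_max f : f != 0 ->
  exists2 a, a \in msupp f & {in msupp f, forall b, w b <= w a}.
Proof. by rewrite -msupp_eq0; exact: seq_argmax. Qed.

Definition weight_part (k : int) f : {mpoly K[n]} :=
  \sum_(m <- msupp f | w m == k) f@_m *: 'X_[m].

Lemma mcoeff_weight_part k f m :
  (weight_part k f)@_m = if w m == k then f@_m else 0.
Proof.
rewrite /weight_part raddf_sum /=.
under eq_bigr do rewrite mcoeffZ mcoeffX.
have [mf|mf] := boolP (m \in msupp f); last first.
  rewrite (memN_msupp_eq0 mf) if_same big_seq_cond big1 // => a /andP[af _].
  by case: eqP mf => [<-|]; rewrite ?af ?mulr0.
rewrite big_mkcond (bigD1_seq m) ?msupp_uniq //= eqxx mulr1 big1 ?addr0 //.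
by move=> a /negPf->; rewrite mulr0 if_same.
Qed.

Lemma msupp_weight_part k f m :
  m \in msupp (weight_part k f) -> (m \in msupp f) /\ w m = k.
Proof.
rewrite mcoeff_msupp mcoeff_weight_part; case: (w m =P k) => [wm|_];
  last by rewrite eqxx.
by rewrite -mcoeff_msupp.
Qed.

Lemma msupp_sub_weight_part k f m : {in msupp f, forall b, w b <= k} ->
  m \in msupp (f - weight_part k f) -> (m \in msupp f) /\ w m < k.
Proof.
move=> fk; rewrite mcoeff_msupp mcoeffB mcoeff_weight_part.
case: (w m =P k) => [_|/eqP wm]; first by rewrite subrr eqxx.
by rewrite subr0 -mcoeff_msupp => mf; rewrite lt_neqAle wm fk.
Qed.

Lemma msuppMP f g m : m \in msupp (f * g) ->
  exists a b, [/\ a \in msupp f, b \in msupp g & m = (a + b)%MM].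
Proof. by move=> /msuppM_le/allpairsP[[a b] /= [af bg ->]]; exists a, b. Qed.

(* The product of the parts of maximal weight is the part of maximal weight of
   the product, and it is nonzero because there are no zero divisors. *)
Lemma top_weightM f g : f != 0 -> g != 0 -> exists a b m,
  [/\ a \in msupp f /\ {in msupp f, forall c, w c <= w a},
      b \in msupp g /\ {in msupp g, forall c, w c <= w b} &
      m \in msupp (f * g) /\ w m = w a + w b].
Proof.
move=> /msupp_max[a af aP] /msupp_max[b bg bP]; exists a, b.
pose f1 := weight_part (w a) f; pose g1 := weight_part (w b) g.
have f10 : f1 != 0.
  apply: contraTneq af => f10; rewrite mcoeff_msupp negbK.
  by have := mcoeff_weight_part (w a) f a; rewrite -/f1 f10 mcoeff0 eqxx => <-.
have g10 : g1 != 0.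
  apply: contraTneq bg => g10; rewrite mcoeff_msupp negbK.
  by have := mcoeff_weight_part (w b) g b; rewrite -/g1 g10 mcoeff0 eqxx => <-.
have [m mfg] : exists m, m \in msupp (f1 * g1).
  exists (mlead (f1 * g1)); apply: mlead_supp; exact: mulf_neq0.
have wm : w m = w a + w b.
  have [c [d [/msupp_weight_part[_ wc] /msupp_weight_part[_ wd] ->]]] :=
    msuppMP mfg.
  by rewrite wD wc wd.
exists m; split=> //; split=> //; rewrite mcoeff_msupp.
have -> : f * g = f1 * g1 + ((f - f1) * g + f1 * (g - g1)).
  rewrite mulrBl mulrBr [X in _ + X]addrA subrK. by rewrite [RHS]addrC subrK.
rewrite mcoeffD [X in _ + X](_ : _ = 0) ?addr0 -?mcoeff_msupp //.
apply: memN_msupp_eq0; apply/negP => /msuppD_le; rewrite mem_cat => /orP[].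
  move=> /msuppMP[c [d [/msupp_sub_weight_part[//|cf wc] dg mE]]].
  have := bP d dg; move: wm; rewrite mE wD; move: wc; lia.
move=> /msuppMP[c [d [/msupp_weight_part[_ wc] /msupp_sub_weight_part[//|dg wd]
  mE]]].
by move: wm; rewrite mE wD; move: wc wd; lia.
Qed.

End TopWeight.

Section Homogeneous.
Variables (K : fieldType) (n r : nat) (wt : 'X_{1..n} -> 'rV[int]_r).
Hypothesis wtD : forall a b : 'X_{1..n}, wt (a + b)%MM = wt a + wt b.
Implicit Types (f g h : {mpoly K[n]}).

(** The leading monomial serves as the reference, so that no degree has to be carried along; the
    zero polynomial is homogeneous. *)
Definition whomog f := {in msupp f, forall m, wt m = wt (mlead f)}.

Definition hdeg f := wt (mlead f).

Lemma wt0 : wt 0%MM = 0.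
Proof. by apply: (addrI (wt 0%MM)); rewrite -wtD addm0 addr0. Qed.

Lemma hdegM f g : f != 0 -> g != 0 -> hdeg (f * g) = hdeg f + hdeg g.
Proof. by move=> f0 g0; rewrite /hdeg mleadM. Qed.

Lemma hdegXm m : hdeg 'X_[m] = wt m.
Proof. by rewrite /hdeg mleadXm. Qed.

Lemma hdegC c : hdeg c%:MP = 0.
Proof. by rewrite /hdeg mleadC wt0. Qed.

Lemma whomogX m : whomog 'X_[m].
Proof. by move=> a; rewrite msuppX inE mleadXm => /eqP->. Qed.

Lemma whomogC c : whomog c%:MP.
Proof.
by move=> a; rewrite msuppC mleadC; case: ifP; rewrite // inE => _ /eqP->.
Qed.

Lemma whomogM f g : whomog f -> whomog g -> whomog (f * g).
Proof.
move=> fH gH m; have [->|f0] := eqVneq f 0; first by rewrite mul0r msupp0.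
have [->|g0] := eqVneq g 0; first by rewrite mulr0 msupp0.
move=> /msuppMP[a [b [/fH aE /gH bE ->]]].
by rewrite mleadM // !wtD aE bE.
Qed.

Lemma whomog_exp f k : whomog f -> whomog (f ^+ k).
Proof.
move=> fH; elim: k => [|k IHk]; first by rewrite expr0 -mpolyC1; exact: whomogC.
by rewrite exprS; apply: whomogM.
Qed.

Lemma hdeg_exp f k : f != 0 -> hdeg (f ^+ k) = hdeg f *+ k.
Proof.
move=> f0; elim: k => [|k IHk]; first by rewrite expr0 -mpolyC1 hdegC.
by rewrite exprS hdegM ?expf_neq0 // IHk mulrS.
Qed.

(** For each coordinate of the degree, the largest weights of the two factors add up to a weight of
    the product, and so do the smallest ones (the largest for the opposite weight). These two sums
    agree, so in each factor the largest and the smallest weight coincide. *)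
Lemma whomog_factor f g : f * g != 0 -> whomog (f * g) -> whomog f.
Proof.
rewrite mulf_eq0 negb_or => /andP[f0 g0] fgH.
suff eq_wt j a b : a \in msupp f -> b \in msupp f -> wt a 0 j <= wt b 0 j.
  move=> a af; apply/rowP => j; apply/eqP; rewrite eq_le.
  by rewrite !eq_wt // mlead_supp.
pose w m := wt m 0 j; have wD c d : w (c + d)%MM = w c + w d.
  by rewrite /w wtD mxE.
have wND c d : - w (c + d)%MM = - w c + - w d by rewrite wD opprD.
have [a1 [b1 [m1 [[a1f a1P] [b1g b1P] [m1fg wm1]]]]] := top_weightM wD f0 g0.
have [a2 [b2 [m2 [[a2f a2P] [b2g b2P] [m2fg wm2]]]]] := top_weightM wND f0 g0.
have : w m1 = w m2 by rewrite /w (fgH _ m1fg) (fgH _ m2fg).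
move=> w12 af bf.
have := a1P a af; have := a1P b bf; have := a2P a af; have := a2P b bf.
have := b1P b2 b2g; rewrite -!/(w _); lia.
Qed.

Lemma mpoly_unitC f : f \is a GRing.unit -> exists2 c, c != 0 & f = c%:MP.
Proof.
move=> fU; have f0 : f != 0 by apply: contraTneq fU => ->; rewrite unitr0.
have g0 : f^-1 != 0 by rewrite invr_eq0.
apply/msize_poly1P; have := msizeM f0 g0; rewrite divrr // msize1.
have := mpolySpred mdeg f0; have := mpolySpred mdeg g0.
by move=> -> ->; rewrite addSn addnS /= => -[/esym/eqP];
  rewrite addn_eq0 => /andP[/eqP->].
Qed.

Lemma mpolyC_unit c : c != 0 -> (c%:MP : {mpoly K[n]}) \is a GRing.unit.
Proof. by rewrite -unitfE; apply: rmorph_unit. Qed.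

Definition homog_prime f := prime_elt f /\ whomog f.

Lemma homog_factorization f : f != 0 -> whomog f -> exists c s,
  [/\ c != 0, {in s, forall g, homog_prime g} & f = c%:MP * \prod_(g <- s) g].
Proof.
move=> f0 fH; have [u [s [/mpoly_unitC[c c0 ->] sP fE]]] := factorial_mpoly f0.
exists c, s; split=> // g gs; split; first exact: sP.
move: fE f0 fH; rewrite (perm_big _ (perm_to_rem gs)) big_cons mulrCA => ->.
exact: whomog_factor.
Qed.

End Homogeneous.

(** * Divisors of monomials, powers of primes, and ranks of abelian groups *)

(** For the finest grading, by all the exponents, the homogeneous elements are the scalar multiples
    of monomials, and [whomog_factor] applies. *)
Lemma divides_monomial (K : fieldType) n (f : {mpoly K[n]}) (m : 'X_{1..n}) :
  divides f 'X_[m] -> exists c a, [/\ c != 0, f = c *: 'X_[a] & (a <= m)%MM].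
Proof.
move=> [g mE]; pose wt (a : 'X_{1..n}) := \row_i (a i)%:Z.
have wtD a b : wt (a + b)%MM = wt a + wt b.
  by apply/rowP => i; rewrite !mxE mnmDE PoszD.
have X0 : 'X_[m] != 0 :> {mpoly K[n]} by rewrite -msupp_eq0 msuppX.
have [f0 g0] : f != 0 /\ g != 0.
  by apply/andP; rewrite -negb_or -mulf_eq0 mulrC -mE.
have fH : whomog wt f.
  apply: (whomog_factor wtD (g := g)); rewrite mulrC -mE //.
  exact: whomogX.
have fsupp a : a \in msupp f -> a = mlead f.
  move=> /fH/rowP wE; apply/mnmP => i.
  by have := wE i; rewrite !mxE => -[].
exists f@_(mlead f), (mlead f); split; first by rewrite mleadc_eq0.
  apply/mpolyP => a; rewrite mcoeffZ mcoeffX; have [<-|na] := eqVneq.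
    by rewrite mulr1.
  rewrite mulr0; apply: memN_msupp_eq0; apply/negP => /fsupp aE.
  by rewrite aE eqxx in na.
have -> : m = (mlead g + mlead f)%MM by rewrite -mleadM // -mE mleadXm.
exact: lem_addl.
Qed.

Lemma prime_exp_cancel (A : idomainType) (p a b : A) k :
  prime_elt p -> ~ divides p a -> divides (p ^+ k) (a * b) ->
  divides (p ^+ k) b.
Proof.
move=> [p0 _ pP] pa; elim: k => [|k IHk] in b *; first by exists b;
  rewrite mulr1.
move=> [c abE]; have [|//|[d bE]] := pP a b; first by exists (c * p ^+ k);
  rewrite abE exprSr mulrA.
have [|e dE] := IHk d; last by exists e; rewrite bE dE exprSr mulrA.
by exists c; apply: (mulIf p0); rewrite -!mulrA -exprSr -abE bE.
Qed.

Lemma prime_not_divides_exp (A : idomainType) (p a : A) k :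
  prime_elt p -> ~ divides p a -> ~ divides p (a ^+ k).
Proof.
move=> [_ pNu pP] pa; elim: k => [|k IHk].
  by rewrite expr0 => /divides_unit; rewrite unitr1 (negPf pNu) => /(_ isT).
by rewrite exprS => /pP[].
Qed.

Lemma ideal_pow_exp (R : comNzRingType) (p : pred R) k t y :
  t \in p -> ideal_pow p k (t ^+ k * y).
Proof.
move=> tp; elim: k => //= k IHk.
exists [:: (1, t ^+ k.+1 * y)]; last by rewrite big_seq1 mul1r.
move=> c; rewrite inE => /eqP->; exists t, (t ^+ k * y).
by rewrite exprS mulrA.
Qed.

(** In the Smith normal form L D R of [M], the last row of D is zero because [k] exceeds [r]. The
    last row of the inverse of L is thus a relation, and it is nonzero as a row of an invertible
    matrix. *)
Lemma integer_relation k r (M : 'M[int]_(k, r)) :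
  (r < k)%N -> exists2 c : 'rV_k, c != 0 & c *m M = 0.
Proof.
move=> rk; have [L LU [R _ [d _ ->]]] := int_Smith_normal_form M.
have k0 : (k.-1 < k)%N by case: k rk {M L LU}.
exists (row (Ordinal k0) (invmx L)).
  apply: contraTneq LU => L0; rewrite -unitmx_inv.
  apply: contraL (oner_neq0 int) => LU.
  have := congr1 (fun v : 'rV_k => (v *m invmx (invmx L)) 0 (Ordinal k0)) L0.
  by rewrite -row_mul mulmxV // mul0mx !mxE eqxx negbK => /eqP.
rewrite -!row_mul !mulmxA mulVmx // mul1mx row_mul.
suff -> : row (Ordinal k0) (\matrix_(i, j) (d`_i *+ (i == j :> nat))) = 0
    :> 'rV_r.
  by rewrite mul0mx.
apply/rowP => j; rewrite !mxE /=; case: eqP => // kj.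
by have := ltn_ord j; rewrite -kj; lia.
Qed.

Lemma has_rank_of_degree (A : zmodType) r (delta : A -> 'rV[int]_r) :
  (forall x y, delta (x - y) = delta x - delta y) -> injective delta ->
  (forall d, exists x, delta x = d) -> has_rank A r.
Proof.
move=> deltaB delta_inj delta_onto.
pose df := GRing.isZmodMorphism.Build A 'rV[int]_r delta deltaB.
pose dm : {additive A -> 'rV[int]_r} := HB.pack delta df.
have deltaMz x m : delta (x *~ m) = delta x *~ m := raddfMz dm m x.
have delta0 : delta 0 = 0 := raddf0 dm.
have delta_sum k (x : 'I_k -> A) : delta (\sum_i x i) = \sum_i delta (x i).
  exact: (raddf_sum dm).
split.
  pose x (i : 'I_r) := sval (cid (delta_onto (delta_mx 0 i))).
  have xE i : delta (x i) = delta_mx 0 i by rewrite /x; case: cid.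
  exists x => c /(congr1 delta); rewrite delta_sum delta0 => /rowP cE i.
  have := cE i; rewrite summxE mxE (bigD1 i) //= big1 => [|j ji].
    by rewrite addr0 deltaMz xE -scaler_int !mxE !eqxx mulr1 intz.
  by rewrite deltaMz xE -scaler_int !mxE eq_sym (negPf ji) mulr0.
move=> k x xP; rewrite leqNgt; apply/negP => rk.
have [c c0 cM] := integer_relation (\matrix_i delta (x i)) rk.
case/negP: c0; apply/eqP/rowP => i; rewrite mxE; move: i; apply: xP.
apply: delta_inj; rewrite delta_sum delta0 -[RHS]cM mulmx_sum_row.
by apply: eq_bigr => i _; rewrite deltaMz rowK -scaler_int intz.
Qed.

(** * The class group of the subring of degree zero *)

Section DegreeZeroSubring.
Variables (K : fieldType) (n r : nat) (wt : 'X_{1..n} -> 'rV[int]_r).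
Hypothesis wtD : forall a b : 'X_{1..n}, wt (a + b)%MM = wt a + wt b.
Hypothesis wt_onto : forall d, exists m, wt m = d.
Hypothesis wt_avoid : forall i d, exists2 m : 'X_{1..n}, m i = 0%N & wt m = d.
Local Notation C := {mpoly K[n]}.
Variables (R : comNzRingType) (phi : {rmorphism R -> C}).
Hypothesis phi_inj : injective phi.
Hypothesis phi_wt : forall x, {in msupp (phi x), forall m, wt m = 0}.
Hypothesis phi_onto : forall f : C, {in msupp f, forall m, wt m = 0} ->
  exists x, phi x = f.
Implicit Types (f g h : C) (x y : R).
Local Notation whomog := (whomog wt).
Local Notation hdeg := (hdeg wt).
Local Notation homog_prime := (homog_prime wt).

Lemma phi_eq0 x : (phi x == 0) = (x == 0).
Proof. by rewrite -(rmorph0 phi) (inj_eq phi_inj). Qed.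

Lemma mpolyXm_neq0 m : 'X_[m] != 0 :> C.
Proof. by rewrite -msupp_eq0 msuppX. Qed.

Lemma phi_hdeg x : x != 0 -> whomog (phi x) /\ hdeg (phi x) = 0.
Proof.
rewrite -phi_eq0 => /mlead_supp/phi_wt d0; split=> // m /phi_wt->.
by rewrite d0.
Qed.

Lemma phi_onto_hdeg f : whomog f -> hdeg f = 0 -> exists x, phi x = f.
Proof. by move=> fH f0; apply: phi_onto => m /fH->. Qed.

(** If [g] is a scalar multiple of a monomial, some variable occurs in it, and the monomial is taken
    without that variable. Any other prime [g] divides no monomial at all. *)
Lemma monomial_avoid g d : prime_elt g ->
  exists2 m, wt m = d & ~ divides g 'X_[m].
Proof.
move=> [g0 gNu _].
have [[i [c [a [c0 gE ai]]]]|gN] := pselect (exists i c a,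
    [/\ c != 0, g = c *: 'X_[a] & a i != 0%N]).
  have [m mi mE] := wt_avoid i d; exists m => // /divides_monomial.
  move=> [c' [a' [c'0 gE' /mnm_lepP/(_ i)]]].
  have -> : a' = a.
    have: mlead g = a by rewrite gE mleadZ_proper ?mleadXm // mcoeffX eqxx
      mulr1.
    by rewrite gE' mleadZ_proper ?mleadXm // mcoeffX eqxx mulr1.
  by rewrite mi leqn0 (negPf ai).
have [m mE] := wt_onto d; exists m => // /divides_monomial[c [a [c0 gE _]]].
have [a0|[i ai]] : a = 0%MM \/ exists i, a i != 0%N.
  have [->|/eqP aN0] := eqVneq a 0%MM; [by left | right].
  apply: contrapT => aN; apply: aN0; apply/mnmP => i; rewrite mnm0E.
  by apply/eqP; apply/negPn/negP => ai; apply: aN; exists i.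
- by case/negP: gNu; rewrite gE a0 mpolyX0 alg_mpolyC; exact: mpolyC_unit.
- by apply: gN; exists i, c, a.
Qed.

(** * The height one primes of [R] are the contractions of the homogeneous primes *)

Definition contraction g : pred R := fun x => `[< divides g (phi x) >].

Lemma contractionP g x : reflect (divides g (phi x)) (x \in contraction g).
Proof. exact: asboolP. Qed.

Lemma contraction_prime g : prime_elt g -> prime_ideal (contraction g).
Proof.
move=> [g0 gNu gP]; split.
  split.
  - by apply/contractionP; rewrite rmorph0; exact: divides0.
  - apply/contractionP; rewrite rmorph1 => /divides_unit.
    by rewrite unitr1 (negPf gNu) => /(_ isT).
  - move=> a x y /contractionP gx /contractionP gy; apply/contractionP.
    by rewrite rmorphD rmorphM; apply: dividesD => //; apply: dividesMl.
move=> x y /contractionP; rewrite rmorphM => /gP[] gd; apply/orP; [left|right];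
  exact/contractionP.
Qed.

(** The passage from C to [R]: a monomial of opposite degree brings [h] into [R], and being prime to
    [g] it does not affect divisibility by [g]. *)
Lemma contraction_twist g h : prime_elt g -> homog_prime h ->
  exists x m, [/\ x != 0, phi x = h * 'X_[m] & ~ divides g 'X_[m]].
Proof.
move=> gP [[h0 _ _] hH]; have [m mE gm] := monomial_avoid (- hdeg h) gP.
have hm0 : h * 'X_[m] != 0 by rewrite mulf_neq0 ?mpolyXm_neq0.
have [||x xE] := @phi_onto_hdeg (h * 'X_[m]).
- by apply: whomogM => //; apply: whomogX.
- by rewrite hdegM ?mpolyXm_neq0 // hdegXm mE subrr.
by exists x, m; rewrite -phi_eq0 xE.
Qed.

Lemma contraction_sub g h : prime_elt g -> homog_prime h ->
  {subset contraction h <= contraction g} -> divides g h.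
Proof.
move=> gP hP hg; have [x [m [_ xE gm]]] := contraction_twist gP hP.
have [_ _ gM] := gP; have [|//|/gm//] := gM h 'X_[m].
rewrite -xE; apply/contractionP/hg/contractionP.
by exists 'X_[m]; rewrite xE mulrC.
Qed.

Lemma contraction_associate u g :
  u \is a GRing.unit -> contraction (u * g) = contraction g.
Proof.
move=> uU; apply/funext => x; apply/asboolP/asboolP => [] [c cE].
  by exists (c * u); rewrite -mulrA.
by exists (c / u); rewrite mulrA divrK.
Qed.

(* The product of elements [g h] of the contractions of the prime factors [g]
   of a nonzero element of [p] is the product of that element by the [h]. *)
Lemma prime_contains_contraction (p : pred R) x : prime_ideal p ->
  x \in p -> x != 0 ->
  exists2 g, homog_prime g & {subset contraction g <= p}.
Proof.
move=> [[p0 p1 pD] pM] xp x0.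
have pMr y z : y \in p -> y * z \in p.
  by move=> yp; rewrite mulrC -[z * y]addr0 pD.
have [xH xd] := phi_hdeg x0.
have [|c [s [c0 sP xE]]] := homog_factorization wtD _ xH;
  first by rewrite phi_eq0.
apply: contrapT => noG.
have {}noG g : g \in s -> exists2 y, y \notin p & divides g (phi y).
  move=> gs; apply: contrapT => gN; apply: noG; exists g; first exact: sP.
  move=> y /contractionP gy; apply: contrapT => /negP yp; apply: gN.
  by exists y.
have : exists y h, y \notin p /\ phi y = h * \prod_(g <- s) g.
  elim: s noG {sP xE} => [|g s IHs] noG; first by exists 1, 1;
    rewrite big_nil rmorph1 mulr1.
  have [g' g's|y [h [yp yE]]] := IHs; first by apply: noG; rewrite inE g's orbT.
  have [z zp [k zE]] := noG g (mem_head _ _).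
  exists (y * z), (h * k); split.
    by apply/negP => /pM; rewrite (negPf yp) (negPf zp).
  by rewrite big_cons rmorphM yE zE mulrACA [X in _ * X]mulrC.
move=> [y [h [yp yE]]].
have [y0|y0] := eqVneq y 0.
  by rewrite y0 p0 in yp.
have [yH yd] := phi_hdeg y0.
have h'0 : (c^-1)%:MP * h != 0 :> C.
  rewrite mulf_neq0 ?mpolyC_eq0 ?invr_eq0 //.
  by apply: contraNneq y0 => h0; rewrite -phi_eq0 yE h0 mul0r.
have yE' : phi y = (c^-1)%:MP * h * phi x.
  by rewrite xE yE mulrACA -mpolyCM mulVf // mul1r.
have [||z zE] := @phi_onto_hdeg ((c^-1)%:MP * h).
- apply: (whomog_factor wtD (g := phi x)); rewrite -yE' //.
  by rewrite phi_eq0.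
- have : hdeg (phi y) = 0 by [].
  by rewrite yE' hdegM ?phi_eq0 // xd addr0.
case/negP: yp; suff -> : y = x * z by apply: pMr.
by apply: phi_inj; rewrite rmorphM zE yE' mulrC.
Qed.

Lemma zero_prime : prime_ideal (pred1 (0 : R)).
Proof.
split; first split.
- by rewrite inE.
- by rewrite inE oner_eq0.
- by move=> a x y; rewrite !inE => /eqP-> /eqP->; rewrite mulr0 addr0.
move=> x y; rewrite !inE -phi_eq0 rmorphM mulf_eq0.
by rewrite !phi_eq0.
Qed.

(** A nonzero prime [q1] inside the contraction of [g] contains the contraction of some homogeneous
    prime [h]. Then [g] divides [h], the two are associate, and [q1] is the whole contraction. *)
Lemma contraction_height_one g : homog_prime g -> height_one (contraction g).
Proof.
move=> gP; have [gp gH] := gP.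
have [x [m [x0 xE _]]] := contraction_twist gp gP.
split; first exact: contraction_prime.
  exists (pred1 0); first exact: zero_prime.
  split=> [y|sub]; first by rewrite inE => /eqP->; apply/contractionP;
    rewrite rmorph0; exact: divides0.
  have : x \in contraction g by apply/contractionP; exists 'X_[m];
    rewrite xE mulrC.
  by move/sub; rewrite inE (negPf x0).
move=> [q0 [q1 [q0P q1P [q01 q10] [q1g gq1]]]].
have [y yq1 yq0] : exists2 y, y \in q1 & y \notin q0.
  apply: contrapT => noy; apply: q10 => y yq1; apply: contrapT => /negP yq0.
  by apply: noy; exists y.
have y0 : y != 0.
  by apply: contraNneq yq0 => ->; case: q0P => -[].
have [h hP hq1] := prime_contains_contraction q1P yq1 y0.
have [hp _] := hP.
have gh : divides g h by apply: contraction_sub => // z /hq1/q1g.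
have [u uU hE] := divides_prime_associate gp hp gh.
by apply: gq1; rewrite -(contraction_associate g uU) -hE.
Qed.

(** The prime [p] contains a contraction; if they differed, zero, this contraction and [p] would
    form a chain that height one excludes. *)
Lemma height_one_contraction (p : pred R) : height_one p ->
  exists2 g, homog_prime g & p = contraction g.
Proof.
move=> [pP [q qP [qp pq]] noq].
have [x xp xq] : exists2 x, x \in p & x \notin q.
  apply: contrapT => nox; apply: pq => x xp; apply: contrapT => /negP xq.
  by apply: nox; exists x.
have x0 : x != 0 by apply: contraNneq xq => ->; case: qP => -[].
have [g gP gp] := prime_contains_contraction pP xp x0; exists g => //.
have [gprime _] := gP; have [y [m [y0 yE _]]] := contraction_twist gprime gP.
apply/funext => z; apply/idP/idP; last exact: gp.
move=> zp; apply: contrapT => /negP zg; apply: noq.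
exists (pred1 0), (contraction g); split.
- exact: zero_prime.
- exact: contraction_prime.
- split=> [t|sub]; first by rewrite inE => /eqP->; apply/contractionP;
    rewrite rmorph0; exact: divides0.
  have : y \in contraction g by apply/contractionP; exists 'X_[m];
    rewrite yE mulrC.
  by move/sub; rewrite inE (negPf y0).
by split=> // sub; move/negP: zg; apply; apply: sub.
Qed.

(** * Orders along height one primes are multiplicities in C *)

Lemma ideal_pow_divides g k x :
  ideal_pow (contraction g) k x -> divides (g ^+ k) (phi x).
Proof.
elim: k x => [|k IHk] x /=; first by exists (phi x); rewrite mulr1.
move=> [s sP ->]; rewrite raddf_sum big_seq /=.
elim/big_ind: _ => [|f h|c /sP[a [b [/contractionP ga /IHk gb ->]]]].
- exact: divides0.
- exact: dividesD.
rewrite rmorphM rmorphM; apply: dividesMl.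
case: ga => a' ->; case: gb => b' ->; exists (a' * b').
by rewrite mulrACA exprS.
Qed.

(* The factor [s] clearing denominators is the [k]-th power of a monomial of
   degree zero, prime to [g], whose two factors have degrees [hdeg g] and
   [- hdeg g]. *)
Lemma local_powP g k x : homog_prime g ->
  local_pow (contraction g) k x <-> divides (g ^+ k) (phi x).
Proof.
move=> gP; have [gp gH] := gP; have [g0 gNu gM] := gp; split.
  move=> [s /contractionP gs /ideal_pow_divides]; rewrite rmorphM.
  exact: prime_exp_cancel.
have [->|x0] := eqVneq x 0 => gx.
  exists 1; first by have [[]] := contraction_prime gp.
  rewrite mulr0 -(mulr0 (0 ^+ k)); apply: ideal_pow_exp.
  by apply/contractionP; rewrite rmorph0; exact: divides0.
have [b xE] := gx.
have [t [m [t0 tE gm]]] := contraction_twist gp gP.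
have [m' m'E gm'] := monomial_avoid (hdeg g) gp.
have wtm : hdeg g + wt m = 0.
  by have [_] := phi_hdeg t0; rewrite tE hdegM ?mpolyXm_neq0 // hdegXm.
have [||s sE] := @phi_onto_hdeg 'X_[m' + m]; first exact: whomogX.
  by rewrite hdegXm wtD m'E.
have gk0 : g ^+ k != 0 by rewrite expf_neq0.
have b0 : b != 0 by apply: contraNneq x0 => b0; rewrite -phi_eq0 xE b0 mul0r.
have [xH xd] := phi_hdeg x0.
have [||y yE] := @phi_onto_hdeg (b * 'X_[m'] ^+ k).
- apply: whomogM => //; last by apply: whomog_exp => //; exact: whomogX.
  by apply: (whomog_factor wtD (g := g ^+ k)); rewrite -xE ?phi_eq0.
- rewrite hdegM ?expf_neq0 ?mpolyXm_neq0 // hdeg_exp ?mpolyXm_neq0 //.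
  rewrite hdegXm m'E -(hdeg_exp wtD) // -hdegM //.
  by rewrite -xE.
exists (s ^+ k).
  apply/contractionP; rewrite rmorphXn sE mpolyXD.
  by apply: prime_not_divides_exp => // /gM[].
have -> : s ^+ k * x = t ^+ k * y.
  apply: phi_inj; rewrite !rmorphM !rmorphXn sE tE xE yE mpolyXD !exprMn.
  by rewrite mulrACA [RHS]mulrC [X in _ = X * _]mulrC [X in _ = _ * X]mulrC.
apply: ideal_pow_exp; apply/contractionP.
by exists 'X_[m]; rewrite tE mulrC.
Qed.

Fact generator_exists (p : height_one_prime R) :
  exists g, homog_prime g /\ val p = contraction g.
Proof.
by have /asboolP/height_one_contraction[g] := valP p; exists g.
Qed.

Definition generator p : C := sval (cid (generator_exists p)).

Lemma generator_homog_prime p : homog_prime (generator p).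
Proof. by rewrite /generator; case: cid => g []. Qed.

Lemma contraction_generator p : val p = contraction (generator p).
Proof. by rewrite /generator; case: cid => g []. Qed.

Lemma generator_neq0 p : generator p != 0.
Proof. by have [[]] := generator_homog_prime p. Qed.

Lemma generator_divides p q : divides (generator p) (generator q) -> p = q.
Proof.
have [pP _] := generator_homog_prime p; have [qP _] := generator_homog_prime q.
move=> /(divides_prime_associate pP qP)[u uU qE]; apply: val_inj.
by rewrite !contraction_generator qE contraction_associate.
Qed.

Lemma homog_prime_generator g : homog_prime g ->
  exists p, exists2 c, c != 0 & g = c%:MP * generator p.
Proof.
move=> gP; have gh := contraction_height_one gP.
pose p : height_one_prime R := exist _ (contraction g) (asboolT gh); exists p.
have [gp _] := gP; have [pp _] := generator_homog_prime p.
have [|u /mpoly_unitC[c c0 ->]] := divides_prime_associate pp gp.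
  apply: contraction_sub => // x; rewrite -contraction_generator //.
by exists c.
Qed.

Lemma homog_generators f : f != 0 -> whomog f -> exists2 c, c != 0 &
  exists s, f = c%:MP * \prod_(p <- s) generator p.
Proof.
move=> f0 /(homog_factorization wtD f0)[c [s [c0 sP ->]]].
elim: s sP => [|g s IHs] sP in c c0 *.
  by exists c => //; exists [::]; rewrite !big_nil.
have [p [d d0 gE]] := homog_prime_generator (sP g (mem_head _ _)).
have [|e e0 [t sE]] := IHs _ (c * d) (mulf_neq0 c0 d0).
  by move=> h hs; apply: sP; rewrite inE hs orbT.
exists e => //; exists (p :: t); rewrite !big_cons [RHS]mulrCA -sE gE.
rewrite mpolyCM -!mulrA [RHS]mulrCA; congr (_ * _); exact: mulrCA.
Qed.

(** Effective divisors are given by lists of primes, so that they match products of generators over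
    the same list. *)
Definition sum_divisor (s : seq (height_one_prime R)) : Weil_divisor R :=
  \sum_(p <- s) << p >>.

Lemma coeff_sum_divisor p s : coeff p (sum_divisor s) = (count_mem p s)%:Z.
Proof.
rewrite /sum_divisor; elim: s => [|q s IHs]; first by rewrite big_nil coeff0.
by rewrite big_cons coeffD IHs coeffU mul1r PoszD /=; case: (q == p).
Qed.

Lemma generators_multiplicity p c s k : c != 0 ->
  divides (generator p ^+ k) (c%:MP * \prod_(q <- s) generator q) <->
  (k <= count_mem p s)%N.
Proof.
move=> c0; have [[p0 pNu pM] _] := generator_homog_prime p.
have pP : prime_elt (generator p) by [].
elim: s k => [|q s IHs] k.
  rewrite big_nil mulr1 leqn0; split=> [|/eqP->]; last by exists c%:MP;
    rewrite mulr1.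
  case: k => // k /divides_unit; rewrite mpolyC_unit // => /(_ isT).
  by rewrite exprS unitrM (negPf pNu).
rewrite big_cons /= mulrCA.
have [->|qp] := eqVneq q p; last first.
  rewrite add0n -IHs; split; last exact: dividesMl.
  apply: prime_exp_cancel => // /generator_divides pq.
  by rewrite pq eqxx in qp.
rewrite add1n; case: k => [|k]; first by split=> // _;
  exists (generator p * (c%:MP * \prod_(q <- s) generator q)); rewrite mulr1.
rewrite ltnS -IHs; split=> [] [d dE]; exists d; last by rewrite dE exprS mulrCA.
by apply: (mulfI p0); rewrite dE exprS mulrCA.
Qed.

Lemma divisor_of_generators x c s : c != 0 ->
  phi x = c%:MP * \prod_(p <- s) generator p -> divisor_of x (sum_divisor s).
Proof.
move=> c0 xE p; exists (count_mem p s); first exact: coeff_sum_divisor.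
rewrite contraction_generator /ord_at.
by rewrite !local_powP ?xE ?generators_multiplicity ?ltnn //;
  exact: generator_homog_prime.
Qed.

Lemma divisor_of_unique x D E : divisor_of x D -> divisor_of x E -> D = E.
Proof.
move=> xD xE; apply/eqP/freeg_eqP => p.
have [j -> [xj xj1]] := xD p; have [k -> [xk xk1]] := xE p.
have gP := generator_homog_prime p.
move: xj xj1 xk xk1; rewrite contraction_generator !local_powP //.
have le i l : divides (generator p ^+ i) (phi x) ->
    ~ divides (generator p ^+ l.+1) (phi x) -> (i <= l)%N.
  move=> xi xl; rewrite leqNgt; apply/negP => li; apply: xl.
  apply: divides_trans xi; exists (generator p ^+ (i - l.+1)).
  by rewrite -exprD subnK.
move=> xj xj1 xk xk1; congr Posz; apply/eqP.
by rewrite eqn_leq !le.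
Qed.

(** * The degree of a divisor, and the class group *)

Definition class_degree : Weil_divisor R -> 'rV[int]_r :=
  fglift (fun p => hdeg (generator p)).

Fact class_degree_is_additive : zmod_morphism class_degree.
Proof. exact: lift_is_additive. Qed.

HB.instance Definition _ :=
  GRing.isZmodMorphism.Build (Weil_divisor R) 'rV[int]_r class_degree
    class_degree_is_additive.

Lemma prod_generators_neq0 s : \prod_(p <- s) generator p != 0.
Proof.
elim/big_ind: _ => [|f g|p _]; [exact: oner_neq0 | exact: mulf_neq0 |].
exact: generator_neq0.
Qed.

Lemma class_degree_sum s :
  class_degree (sum_divisor s) = hdeg (\prod_(p <- s) generator p).
Proof.
rewrite raddf_sum /=; elim: s => [|p s IHs].
  by rewrite !big_nil -mpolyC1 hdegC.
rewrite !big_cons IHs hdegM ?generator_neq0 ?prod_generators_neq0 //.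
by congr (_ + _); rewrite /class_degree liftU scale1r.
Qed.

Lemma class_degree_divisor_of x D : x != 0 -> divisor_of x D -> class_degree D
  = 0.
Proof.
move=> x0 xD; have [xH xd] := phi_hdeg x0.
have [|c c0 [s xE]] := homog_generators _ xH; first by rewrite phi_eq0.
rewrite (divisor_of_unique xD (divisor_of_generators c0 xE)) class_degree_sum.
by rewrite -xd xE hdegM ?mpolyC_eq0 ?prod_generators_neq0 // hdegC // add0r.
Qed.

Lemma principal_class_degree D : D \in @principal R -> class_degree D = 0.
Proof.
move=> /asboolP[s sP ->]; rewrite raddf_sum big_seq big1 //= => c /sP[x x0 xD].
by rewrite raddfMz /= (class_degree_divisor_of x0 xD) mul0rz.
Qed.

Lemma sum_divisor_decomposition D :
  exists s t, D = sum_divisor s - sum_divisor t.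
Proof.
rewrite -[D]freeg_sumE; elim/big_ind: _ => [|D1 D2|p _].
- by exists [::], [::]; rewrite subrr.
- move=> [s1 [t1 ->]] [s2 [t2 ->]]; exists (s1 ++ s2), (t1 ++ t2).
  by rewrite /sum_divisor !big_cat opprD addrACA.
have sum_nseq k : sum_divisor (nseq k p) = << k%:Z *g p >>.
  rewrite /sum_divisor big_nseq; elim: k => [|k IHk] /=;
    first by rewrite freegU0.
  by rewrite IHk freegUD.
case: (coeff p D) => k.
  by exists (nseq k p), [::]; rewrite sum_nseq /sum_divisor big_nil subr0.
by exists [::], (nseq k.+1 p);
  rewrite sum_nseq /sum_divisor big_nil sub0r freegUN.
Qed.

(** Write [D] as a difference of effective divisors. The two products of generators have the same
    degree, so one monomial of opposite degree brings both into [R]; its own divisor cancels in the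
    difference. *)
Lemma class_degree_principal D : class_degree D = 0 -> D \in @principal R.
Proof.
have [s [t ->]] := sum_divisor_decomposition D.
rewrite raddfB /= !class_degree_sum => /eqP; rewrite subr_eq0 => /eqP hst.
set f := \prod_(p <- s) _ in hst; set g := \prod_(p <- t) _ in hst.
have [m mE] := wt_onto (- hdeg f).
have [c c0 [l lE]] := homog_generators (mpolyXm_neq0 m) (@whomogX K n r wt m).
have prodH u : whomog (\prod_(p <- u) generator p).
  elim: u => [|p u IHu]; first by rewrite big_nil -mpolyC1; exact: whomogC.
  by rewrite big_cons; apply: whomogM => //; have [] := generator_homog_prime p.
have lift u : hdeg (\prod_(p <- u) generator p) = hdeg f -> exists2 x, x != 0 &
    divisor_of x (sum_divisor u + sum_divisor l).
  move=> uf; have u0 := prod_generators_neq0 u.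
  have [||x xE] := @phi_onto_hdeg (\prod_(p <- u) generator p * 'X_[m]).
  - by apply: whomogM => //; exact: whomogX.
  - by rewrite hdegM ?mpolyXm_neq0 // uf hdegXm mE subrr.
  exists x; first by rewrite -phi_eq0 xE mulf_neq0 ?mpolyXm_neq0.
  have -> : sum_divisor u + sum_divisor l = sum_divisor (u ++ l).
    by rewrite /sum_divisor big_cat.
  by apply: (divisor_of_generators c0); rewrite xE lE big_cat /= mulrCA.
have [x x0 xD] := lift s erefl; have [y y0 yD] := lift t (esym hst).
apply/asboolP; exists [:: (1, sum_divisor s + sum_divisor l);
                         (-1, sum_divisor t + sum_divisor l)].
  by move=> d; rewrite !inE => /orP[] /eqP->; [exists x | exists y].
rewrite big_cons big_seq1 /= mulr1z mulrN1z opprD.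
by rewrite addrACA subrr addr0.
Qed.

Lemma class_degree_onto d : exists D, class_degree D = d.
Proof.
have [m mE] := wt_onto d.
have [c c0 [l lE]] := homog_generators (mpolyXm_neq0 m) (@whomogX K n r wt m).
exists (sum_divisor l); rewrite class_degree_sum -mE -(@hdegXm K n r wt) lE.
by rewrite hdegM ?mpolyC_eq0 ?prod_generators_neq0 // hdegC // add0r.
Qed.

Theorem has_rank_Cl_degree : has_rank (Cl R) r.
Proof.
pose I : zmodClosed (Weil_divisor R) := GRing.ZmodClosed.clone _ (@principal R)
  _.
have eqCl D E : (\pi_({ideal_quot I}) D = \pi_({ideal_quot I}) E)%qT <->
    class_degree D = class_degree E.
  split=> [/eqP|DE].
    rewrite -Quotient.idealrBE => /principal_class_degree.
    by rewrite raddfB /= => /eqP; rewrite subr_eq0 => /eqP.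
  apply/eqP; rewrite -Quotient.idealrBE; apply: class_degree_principal.
  by rewrite raddfB /= DE subrr.
pose delta (x : {ideal_quot I}) := class_degree (repr x).
have deltaE D : delta (\pi_({ideal_quot I}) D)%qT = class_degree D.
  by apply/eqCl; rewrite reprK.
apply: (@has_rank_of_degree {ideal_quot I} r delta).
- move=> x y; rewrite -[x]reprK -[y]reprK.
  by rewrite -raddfB !deltaE raddfB.
- move=> x y /eqCl; by rewrite !reprK.
- by move=> d; have [D <-] := class_degree_onto d;
    exists (\pi_({ideal_quot I}) D)%qT.
Qed.

End DegreeZeroSubring.

(** * The grading attached to a graph *)

Section IndexedMonomials.
Variables (T : finType) (J : {set T}).
Implicit Types (m : 'X_{1..#|J|}) (x : T).

(** The sum has one term when [x] is in [J] and none otherwise, so exponents are read at elements of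
    [T], with value 0 outside [J]. *)
Definition mnm_at m x := (\sum_(i < #|J| | enum_val i == x) m i)%N.

Definition mnm_of (f : T -> nat) : 'X_{1..#|J|} :=
  [multinom f (enum_val i) | i < #|J|].

Lemma mnm_at_enum_val m (i : 'I_#|J|) : mnm_at m (enum_val i) = m i.
Proof.
by rewrite /mnm_at (big_pred1 i) // => j; rewrite /= (inj_eq enum_val_inj).
Qed.

Lemma mnm_at_of f x : x \in J -> mnm_at (mnm_of f) x = f x.
Proof.
move=> xJ; have [i ->] : exists i : 'I_#|J|, x = enum_val i.
  by exists (enum_rank_in xJ x); rewrite enum_rankK_in.
by rewrite mnm_at_enum_val mnmE.
Qed.

Lemma mnm_at_inj m1 m2 :
  (forall x, x \in J -> mnm_at m1 x = mnm_at m2 x) -> m1 = m2.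
Proof.
by move=> eqm; apply/mnmP => i; rewrite -!mnm_at_enum_val eqm ?enum_valP.
Qed.

Lemma mnm_atD m1 m2 x : mnm_at (m1 + m2)%MM x = (mnm_at m1 x + mnm_at m2 x)%N.
Proof.
by rewrite /mnm_at -big_split; apply: eq_bigr => i _; rewrite mnmDE.
Qed.

Lemma mnm_atMn m k x : mnm_at (m *+ k)%MM x = (mnm_at m x * k)%N.
Proof.
by rewrite /mnm_at big_distrl; apply: eq_bigr => i _; rewrite mulmnE.
Qed.

Lemma mnm_at_sum (I : finType) (F : I -> 'X_{1..#|J|}) x :
  mnm_at (\sum_(i : I) F i)%MM x = (\sum_i mnm_at (F i) x)%N.
Proof.
apply: (big_morph (fun m => mnm_at m x)) => [m1 m2|]; first exact: mnm_atD.
by rewrite /mnm_at big1 // => i _; rewrite mnm0E.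
Qed.

End IndexedMonomials.

Section GraphRays.
Variables (n : nat) (e : rel 'I_n).
Hypothesis simple_e : simple_graph e.
Implicit Types (v w i j : 'I_n) (A : {set 'I_n}).

Let e_sym : symmetric e. Proof. by case: simple_e. Qed.
Let e_irr : irreflexive e. Proof. by case: simple_e. Qed.

Definition nbr v := [set w | e v w].

Local Notation T := ('I_n * {set 'I_n} + 'I_n * 'I_n)%type.

Definition rays : {set T} :=
  [set x : T | match x with
           | inl (v, A) => A \subset nbr v
           | inr (i, j) => (i != j) && ~~ e i j
           end].

Local Notation N := #|rays|.
Implicit Types (m : 'X_{1..N}) (u : 'X_{1..n * n}).

Lemma vray_in v A : (inl (v, A) \in rays) = (A \subset nbr v).
Proof. by rewrite inE. Qed.

Lemma fray_in i j : (inr (i, j) \in rays) = (i != j) && ~~ e i j.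
Proof. by rewrite inE. Qed.

Definition var_order i j (x : T) : nat :=
  match x with
  | inl (v, A) => ((i == j) && (v == i)) + [&& e i j, v == i & j \in A]
                    + [&& e i j, v == j & i \notin A]
  | inr p => p == (i, j)
  end.

Definition var_image : 'I_(n * n) -> 'X_{1..N} :=
  mxvec (\matrix_(i, j) mnm_of rays (var_order i j)) 0.

Definition mon_image u : 'X_{1..N} := (\sum_k var_image k *+ u k)%MM.

Definition expo u i j : nat := u (mxvec_index i j).

Lemma mon_imageE u x : x \in rays ->
  mnm_at (mon_image u) x = (\sum_i \sum_j expo u i j * var_order i j x)%N.
Proof.
move=> xJ; rewrite mnm_at_sum pair_bigA /=.
rewrite (reindex _ (curry_mxvec_bij _ _)) /=; apply: eq_bigr => -[i j] _ /=.
by rewrite mnm_atMn /var_image mxvecE mxE mnm_at_of // mulnC.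
Qed.

Lemma mon_image_fray u i j : i != j -> ~~ e i j ->
  mnm_at (mon_image u) (inr (i, j)) = expo u i j.
Proof.
move=> ij eij; rewrite mon_imageE ?fray_in ?ij //.
rewrite (bigD1 i) //= (bigD1 j) //= eqxx muln1 big1 ?addn0 => [|k kj].
  rewrite big1 ?addn0 // => k ki; rewrite big1 // => l _.
  by rewrite xpair_eqE eq_sym (negPf ki) muln0.
by rewrite xpair_eqE eqxx eq_sym (negPf kj) muln0.
Qed.

Lemma mon_image_vray u v A : A \subset nbr v ->
  mnm_at (mon_image u) (inl (v, A)) =
  (expo u v v + \sum_(j in A) expo u v j + \sum_(j in nbr v :\: A) expo u j
    v)%N.
Proof.
move=> Av; rewrite mon_imageE ?vray_in //.
under eq_bigr => i _ do (under eq_bigr => j _ do rewrite /= !mulnDr;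
  rewrite !big_split /=).
rewrite !big_split /=; congr (_ + _ + _)%N.
- rewrite (bigD1 v) //= (bigD1 v) //= eqxx muln1 big1 => [|j jv].
    by rewrite big1 ?addn0 // => i iv; rewrite big1 // => j _;
      rewrite [v == i]eq_sym (negPf iv) andbF muln0.
  by rewrite eq_sym (negPf jv) muln0.
- rewrite (bigD1 v) //= [X in (_ + X)%N]big1 ?addn0 => [|i iv]; last first.
    by rewrite big1 // => j _; rewrite [v == i]eq_sym (negPf iv) andbF muln0.
  rewrite [RHS]big_mkcond; apply: eq_bigr => j _; rewrite eqxx /=.
  case: ifP => [jA|]; last by rewrite andbF muln0.
  by have := subsetP Av j jA; rewrite inE => ->; rewrite muln1.
rewrite exchange_big (bigD1 v) //= [X in (_ + X)%N]big1 ?addn0 => [|i iv];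
  last first.
  by rewrite big1 // => j _; rewrite [v == i]eq_sym (negPf iv) andbF muln0.
rewrite [RHS]big_mkcond; apply: eq_bigr => j _;
  rewrite eqxx !inE /= [e j v]e_sym andbC.
by case: ifP; rewrite ?muln1 ?muln0.
Qed.

Implicit Types (D E : 'I_n -> {set 'I_n} -> int).

(* The monomials of degree zero are those for which the exponent [D v A] of
   y_(v,A) is [D v set0] plus a sum over [w] in [A] of terms [b v w], with
   [b] antisymmetric. For them, [b v w] is [slope D v w] and [defect D]
     vanishes;
   an exponent is determined by its essential defects up to these monomials. *)
Definition slope D v w : int :=
  if (v < w)%N then D v [set w] - D v set0 else D w set0 - D w [set v].

Definition defect D v A : int := D v A - D v set0 - \sum_(w in A) slope D v w.

Definition va m v A : int := (mnm_at m (inl (v, A)))%:Z.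

Lemma nbr_sub1 v w : ([set w] \subset nbr v) = e v w.
Proof. by rewrite sub1set inE. Qed.

Lemma slope_anti D v w : e v w -> slope D v w = - slope D w v.
Proof.
move=> vw; rewrite /slope; case: (ltngtP v w) => [_|_|/val_inj vE].
- by rewrite opprB.
- by rewrite opprB.
by rewrite vE e_irr in vw.
Qed.

Lemma defectD D E v A : defect (fun v A => D v A + E v A) v A =
  defect D v A + defect E v A.
Proof.
rewrite /defect; under eq_bigr => w _ do
  (rewrite (_ : slope _ v w = slope D v w + slope E v w); last by
     rewrite /slope; case: ifP => _; rewrite opprD addrACA).
by rewrite big_split /= !opprD (addrACA (D v A)) [LHS]addrACA.
Qed.

Lemma slope_affine D E (a : 'I_n -> int) (b : 'I_n -> 'I_n -> int) :
  (forall v w, e v w -> b v w = - b w v) ->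
  (forall v A, A \subset nbr v -> D v A = E v A + a v + \sum_(w in A) b v w) ->
  forall v w, e v w -> slope D v w = slope E v w + b v w.
Proof.
move=> b_anti DE v w vw; have wv : e w v by rewrite e_sym.
rewrite /slope !DE ?nbr_sub1 ?sub0set // !big_set1 !big_set0.
by case: ifP => _; rewrite 1?(b_anti v w) //; lia.
Qed.

(** The slopes change by [b] and the values at the empty set by [a], which cancels in the defect.
    This is used with [E] zero for images of monomials, and with [E] a prescribed weight whose
    values have to be made nonnegative. *)
Lemma defect_affine D E (a : 'I_n -> int) (b : 'I_n -> 'I_n -> int) :
  (forall v w, e v w -> b v w = - b w v) ->
  (forall v A, A \subset nbr v -> D v A = E v A + a v + \sum_(w in A) b v w) ->
  forall v A, A \subset nbr v -> defect D v A = defect E v A.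
Proof.
move=> b_anti DE v A Av; rewrite /defect !DE ?sub0set // big_set0.
have -> : \sum_(w in A) slope D v w = \sum_(w in A) (slope E v w + b v w).
  apply: eq_bigr => w /(subsetP Av); rewrite inE;
    exact: (slope_affine b_anti DE).
have rearrange (p q s x y : int) :
    p + q + x - (s + q + 0) - (y + x) = p - s - y by lia.
by rewrite big_split; exact: rearrange.
Qed.

(** As [slope] reads the edge {v, w} at its smaller end, the defect vanishes by construction at the
    empty sets and at the pairs (v, {w}) with v < w. The pairs that remain are the coordinates of
    the degree. *)
Definition essential : {set 'I_n * {set 'I_n}} :=
  [set q : _ * {set _} | [&& q.2 \subset nbr q.1, q.2 != set0 &
             ~~ [exists w, (q.2 == [set w]) && (q.1 < w)%N]]].

Lemma defect_inessential D v A : A \subset nbr v -> (v, A) \notin essential ->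
  defect D v A = 0.
Proof.
rewrite inE /= => -> /=; rewrite negb_and !negbK => /orP[/eqP->|].
  by rewrite /defect big_set0 subrr subr0.
move=> /existsP[w /andP[/eqP-> vw]].
by rewrite /defect big_set1 /slope vw subrr.
Qed.

Definition weight m : 'rV[int]_#|essential| :=
  \row_k defect (va m) (enum_val k).1 (enum_val k).2.

Lemma weightD m1 m2 : weight (m1 + m2)%MM = weight m1 + weight m2.
Proof.
apply/rowP => k; rewrite !mxE -defectD; congr (defect _ _ _).
by apply/funext => v; apply/funext => A; rewrite /va mnm_atD PoszD.
Qed.

Lemma weight_eq0 m : weight m = 0 <->
  forall v A, A \subset nbr v -> defect (va m) v A = 0.
Proof.
split=> [/rowP m0 v A Av|m0]; last first.
  apply/rowP => k; rewrite !mxE; apply: m0.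
  by have := enum_valP k; rewrite inE => /andP[].
have [vA|vA] := boolP ((v, A) \in essential); last exact: defect_inessential.
by have := m0 (enum_rank_in vA (v, A)); rewrite !mxE enum_rankK_in.
Qed.

Definition image_slope u v w : int := (expo u v w)%:Z - (expo u w v)%:Z.

Definition image_base u v : int := (expo u v v + \sum_(w in nbr v) expo u w
  v)%N.

(** The exponent of x_vw counts when w is in A and that of x_wv when it is not. The latter is a
    constant minus a term for w in A, whence the antisymmetric difference. *)
Lemma va_image u v A : A \subset nbr v ->
  va (mon_image u) v A = image_base u v + \sum_(w in A) image_slope u v w.
Proof.
move=> Av; rewrite /va /image_base mon_image_vray //.
have -> : (\sum_(w in nbr v) expo u w v =
    \sum_(w in A) expo u w v + \sum_(w in nbr v :\: A) expo u w v)%N.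
  by rewrite (big_setID A) /= (setIidPr Av).
rewrite sumrB !PoszD.
have Posz_sum (F : 'I_n -> nat) : (\sum_(w in A) F w)%:Z = \sum_(w in A) (F
  w)%:Z.
  exact: (big_morph Posz PoszD).
rewrite -!Posz_sum; move: (\sum_(w in A) expo u w v)%N (\sum_(w in A) expo u v
  w)%N.
by move=> x y; lia.
Qed.

Lemma image_slope_anti u v w : image_slope u v w = - image_slope u w v.
Proof. by rewrite /image_slope opprB. Qed.

Lemma weight_image u : weight (mon_image u) = 0.
Proof.
apply/weight_eq0 => v A Av.
rewrite (@defect_affine _ (fun _ _ => 0) (image_base u) (image_slope u) _ _ v A
  Av).
- rewrite /defect big1 ?subrr // => w _.
  by rewrite /slope; case: ifP; rewrite subrr.
- by move=> v1 w _; exact: image_slope_anti.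
by move=> v1 A1 Av1; rewrite va_image // add0r.
Qed.

(* [x_ij] and [x_ji] do not both occur, for every edge [{i, j}]. *)
Definition standard u := forall i j, e i j -> expo u i j = 0%N \/ expo u j i =
  0%N.

Lemma slope_image u v w : e v w -> slope (va (mon_image u)) v w = image_slope u
  v w.
Proof.
move=> vw.
rewrite (@slope_affine _ (fun _ _ => 0) (image_base u) (image_slope u) _ _ v w
  vw).
- by rewrite /slope; case: ifP => _; rewrite subrr add0r.
- by move=> v1 w1 _; exact: image_slope_anti.
by move=> v1 A Av; rewrite va_image // add0r.
Qed.

Lemma expo_inj u1 u2 : (forall i j, expo u1 i j = expo u2 i j) -> u1 = u2.
Proof. by move=> equ; apply/mnmP => k; case/mxvec_indexP: k => i j;
  exact: equ. Qed.

(** The slopes give the difference of the exponents of x_ij and x_ji, hence both exponents since one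
    of them is 0. The values at the empty sets then give the diagonal exponents, and the y_ij the
    others. *)
Lemma standard_inj u1 u2 : standard u1 -> standard u2 ->
  mon_image u1 = mon_image u2 -> u1 = u2.
Proof.
move=> st1 st2 eq12.
have edge i j : e i j -> expo u1 i j = expo u2 i j.
  move=> ij; have := slope_image u1 ij;
    rewrite eq12 slope_image // /image_slope.
  by have := st1 i j ij; have := st2 i j ij; lia.
apply: expo_inj => i j; have [ij|ij] := boolP (e i j); first exact: edge.
have [<-|ij'] := eqVneq i j; last by rewrite -!mon_image_fray // eq12.
have := va_image u1 (sub0set (nbr i));
  rewrite eq12 va_image ?sub0set // !big_set0.
rewrite !addr0 => -[]; rewrite (eq_bigr (fun w => expo u1 w i)) => [/addIn//|w].
by rewrite inE e_sym => /edge.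
Qed.

(** The exponents of the standard monomial with image [m]: positive parts of the slopes on the
    edges, and on the diagonal what these leave of the value at the empty set. *)
Definition pos_slope m i j : int := Num.max (slope (va m) i j) 0.

Definition diag_expo m i : int := va m i set0 - \sum_(w in nbr i) pos_slope m w
  i.

Definition standard_preimage m : 'X_{1..n * n} :=
  [multinom mxvec (\matrix_(i, j)
     if e i j then absz (pos_slope m i j)
     else if i == j then absz (diag_expo m i)
     else mnm_at m (inr (i, j))) 0%R k | k < n * n].

Lemma expo_standard_preimage m i j : expo (standard_preimage m) i j =
  if e i j then absz (pos_slope m i j)
  else if i == j then absz (diag_expo m i)
  else mnm_at m (inr (i, j)).
Proof. by rewrite /expo mnmE mxvecE mxE. Qed.

Lemma standard_preimageP m : standard (standard_preimage m).
Proof.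
move=> i j ij; rewrite !expo_standard_preimage ij e_sym ij /pos_slope.
by rewrite (slope_anti _ ij); lia.
Qed.

(** This integer is itself an exponent of [m], namely that of y_(i,A) for A the set of the
    neighbours of negative slope. *)
Lemma diag_expo_ge0 m i : weight m = 0 -> 0 <= diag_expo m i.
Proof.
move=> /weight_eq0 m0; pose A := [set w in nbr i | slope (va m) i w < 0].
have Ai : A \subset nbr i by apply/subsetP => w; rewrite inE => /andP[].
suff -> : diag_expo m i = va m i A by [].
have := m0 i A Ai; rewrite /defect /diag_expo.
have -> : \sum_(w in A) slope (va m) i w = - \sum_(w in nbr i) pos_slope m w i.
  rewrite -sumrN big_mkcond [RHS]big_mkcond; apply: eq_bigr => w _.
  rewrite /A !inE; have [iw|//] := boolP (e i w).
  rewrite /pos_slope [slope _ w i]slope_anti 1?e_sym //=.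
  by case: ifP; lia.
lia.
Qed.

Lemma standard_preimageK m : weight m = 0 -> mon_image (standard_preimage m) =
  m.
Proof.
move=> wm; have /weight_eq0 m0 := wm; apply: mnm_at_inj => -[[v A]|[i j]].
  rewrite vray_in => Av; suff : va (mon_image (standard_preimage m)) v A = va m
    v A by case.
  have -> : va m v A = va m v set0 + \sum_(w in A) slope (va m) v w.
    by have := m0 v A Av; rewrite /defect; lia.
  rewrite va_image //; congr (_ + _).
    rewrite /image_base expo_standard_preimage e_irr eqxx.
    have -> : va m v set0 = diag_expo m v + \sum_(w in nbr v) pos_slope m w v.
      by rewrite /diag_expo subrK.
    rewrite PoszD gez0_abs ?diag_expo_ge0 //; congr (_ + _).
    rewrite (big_morph Posz PoszD (erefl _)); apply: eq_bigr => w;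
      rewrite inE => vw.
    by rewrite expo_standard_preimage e_sym vw gez0_abs // /pos_slope; lia.
  apply: eq_bigr => w /(subsetP Av); rewrite inE => vw.
  rewrite /image_slope !expo_standard_preimage vw e_sym vw /pos_slope.
  by rewrite (slope_anti _ vw); lia.
rewrite fray_in => /andP[ij eij]; rewrite mon_image_fray //.
by rewrite expo_standard_preimage (negPf eij) (negPf ij).
Qed.

(** The size of the symmetric difference has the affine form of a monomial of degree zero, and it
    vanishes only at [A0]. It serves in [weight_preimage] to single out a ray. *)
Lemma card_setDU (A A0 : {set 'I_n}) :
  #|A0|%:Z + \sum_(w in A) (if w \in A0 then -1 else 1) =
  (#|A0 :\: A| + #|A :\: A0|)%N.
Proof.
rewrite (big_setID A0) /= (eq_bigr (fun _ => -1)) => [|w]; last first.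
  by rewrite inE => /andP[_ ->].
rewrite [X in _ + (_ + X)](eq_bigr (fun _ => 1)) => [|w]; last first.
  by rewrite inE => /andP[/negPf->].
rewrite !sumr_const -(cardsID A A0) setIC.
by rewrite mulNrn !natz PoszD addrACA subrr add0r PoszD.
Qed.

Definition weight_value (d : 'rV[int]_#|essential|) v A : int :=
  \sum_(k < #|essential| | enum_val k == (v, A)) d 0 k.

Lemma weight_value_enum d k :
  weight_value d (enum_val k).1 (enum_val k).2 = d 0 k.
Proof.
rewrite /weight_value (big_pred1 k) // => j /=.
by rewrite -surjective_pairing (inj_eq enum_val_inj).
Qed.

Lemma weight_value_inessential d v A :
  (v, A) \notin essential -> weight_value d v A = 0.
Proof.
move=> vA; rewrite /weight_value big1 // => k /eqP kE.
by rewrite -kE enum_valP in vA.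
Qed.

Lemma weight_value_bound d v A :
  `|weight_value d v A| <= \sum_k `|d 0 k|.
Proof.
rewrite (le_trans (ler_norm_sum _ _ _)) // big_mkcond ler_sum // => k _.
by case: ifP.
Qed.

(** All slopes of [weight_value d] vanish, because they are read at inessential pairs. *)
Lemma defect_weight_value d v A : A \subset nbr v ->
  defect (weight_value d) v A = weight_value d v A.
Proof.
move=> Av; have d0 w : weight_value d w set0 = 0.
  by rewrite weight_value_inessential // inE /= eqxx andbF.
have d1 w1 w2 : (w1 < w2)%N -> weight_value d w1 [set w2] = 0.
  move=> lt12; rewrite weight_value_inessential // inE /= !negb_and !negbK.
  by apply/orP; right; apply/orP; right; apply/existsP; exists w2; rewrite eqxx.
rewrite /defect d0 subr0 big1 ?subr0 // => w /(subsetP Av); rewrite inE => vw.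
rewrite /slope !d0; case: ltngtP => [vw'|wv|/val_inj vE].
- by rewrite d1 ?subr0.
- by rewrite d1 ?subr0.
by rewrite vE e_irr in vw.
Qed.

(** Corrections [a] and [b] of degree zero turn the weight [d], read as a function on pairs, into
    admissible exponents. The y_ij get exponent 0, which settles the case where [x] is one of
    them. *)
Lemma weight_preimage_affine d (x : T) (a : 'I_n -> int) (b : 'I_n -> 'I_n ->
  int)
    (g := fun v A => weight_value d v A + a v + \sum_(w in A) b v w) :
  (forall v w, e v w -> b v w = - b w v) ->
  (forall v A, A \subset nbr v -> 0 <= g v A) ->
  (forall v A, x = inl (v, A) -> g v A = 0) ->
  exists2 m, mnm_at m x = 0%N & weight m = d.
Proof.
move=> b_anti g_ge0 gx.
pose f (y : T) : nat := if y is inl (v, A) then absz (g v A) else 0%N.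
exists (mnm_of rays f).
  have [xJ|xJ] := boolP (x \in rays).
    by rewrite mnm_at_of //; case: x gx {xJ} => // -[v A] /(_ v A erefl) /= ->.
  rewrite /mnm_at big_pred0 // => k; apply: contraNF xJ => /eqP <-.
  exact: enum_valP.
apply/rowP => k; rewrite mxE -weight_value_enum.
have := enum_valP k; rewrite inE => /andP[Av _].
rewrite -[RHS]defect_weight_value //.
apply: (@defect_affine _ _ a b) => // v A vA.
by rewrite /va mnm_at_of ?vray_in // gez0_abs ?g_ge0.
Qed.

(* The values of [d] are made nonnegative by adding twice their bound [B] times
   an element [u] of degree zero that is positive except at the given ray. *)
Lemma weight_preimage (i : 'I_#|rays|) d :
  exists2 m : 'X_{1..N}, m i = 0%N & weight m = d.
Proof.
pose B : int := \sum_k `|d 0 k|.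
suff [m mi mE] : exists2 m, mnm_at m (enum_val i) = 0%N & weight m = d.
  by exists m; rewrite // -mi mnm_at_enum_val.
have B_ge0 : 0 <= B by apply: sumr_ge0 => k _; exact: normr_ge0.
have dB v A : - B <= weight_value d v A <= B by rewrite -ler_norml
  weight_value_bound.
have := enum_valP i; case: (enum_val i) => [[v0 A0]|p] xJ; last first.
  apply: (@weight_preimage_affine _ _ (fun _ => B) (fun _ _ => 0)) => // v A _.
  by rewrite big1 // addr0; have := dB v A; lia.
rewrite vray_in in xJ.
have v0A A : A \subset nbr v0 -> v0 \notin A.
  by move=> Av; apply/negP => /(subsetP Av); rewrite inE e_irr.
pose s w : int := if w \in A0 then -1 else 1.
pose b v w : int := if v == v0 then s w else if w == v0 then - s v else 0.
(* At [v0] this makes [u] the size of the symmetric difference with [A0]. At any other vertex the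
   only possibly nonzero slope, towards [v0], is 1 or -1, and 2 keeps [u] at least 1. *)
pose a v : int := if v == v0 then #|A0|%:Z else 2.
have b_anti v w : e v w -> b v w = - b w v.
  move=> vw; rewrite /b; have [vE|_] := eqVneq v v0; have [wE|_] := eqVneq w v0.
  - by rewrite vE wE e_irr in vw.
  - by rewrite opprK.
  - by [].
  - by rewrite oppr0.
pose u v A := a v + \sum_(w in A) b v w.
have u_v0 A : A \subset nbr v0 -> u v0 A = (#|A0 :\: A| + #|A :\: A0|)%N.
  move=> Av; rewrite /u /a eqxx -card_setDU; congr (_ + _).
  by apply: eq_bigr => w _; rewrite /b eqxx.
have u_gt0 v A : A \subset nbr v -> (v, A) != (v0, A0) -> 1 <= u v A.
  have [->|vv0] := eqVneq v v0 => Av.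
    rewrite xpair_eqE eqxx /= => AA0; rewrite u_v0 // lez_nat.
    rewrite addn_gt0 !card_gt0; apply: contraR AA0.
    by rewrite negb_or !negbK !setD_eq0 eqEsubset andbC.
  move=> _; rewrite /u /a (negPf vv0).
  have [v0A'|v0A'] := boolP (v0 \in A).
    rewrite (bigD1 v0) //= big1 => [|w /andP[_ wv0]]; last first.
      by rewrite /b (negPf vv0) (negPf wv0).
    by rewrite /b (negPf vv0) eqxx /s; case: ifP.
  rewrite big1 // => w wA; rewrite /b (negPf vv0) (negPf (_ : w != v0)) //.
  by apply: contraNneq v0A' => <-.
(* Subtracting [c] at [v0] makes the exponent at the given ray exactly 0. Both [c] and the value of
   [d] can cost up to [B], whence the factor 2. *)
pose c := weight_value d v0 A0.
have gE v A : weight_value d v A + (2 * B * a v - (if v == v0 then c else 0)) +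
    \sum_(w in A) 2 * B * b v w =
    weight_value d v A + 2 * B * u v A - (if v == v0 then c else 0).
  by rewrite -mulr_sumr /u mulrDr -!addrA; congr (_ + (_ + _)); rewrite addrC.
apply: (@weight_preimage_affine _ _
  (fun v => 2 * B * a v - (if v == v0 then c else 0)) (fun v w => 2 * B * b v
    w)).
- by move=> v w vw; rewrite b_anti // mulrN.
- move=> v A Av; rewrite gE; have [vA|vA] := eqVneq (v, A) (v0, A0).
    case: vA => -> ->; rewrite eqxx u_v0 // setDv cards0 mulr0 addr0 subrr.
    by [].
  have Bu : B <= B * u v A by rewrite ler_peMr ?u_gt0.
  have := dB v A; have := dB v0 A0; rewrite -/c; move: Bu.
  rewrite -mulrA; move: (B * u v A) => x.
  by case: ifP; lia.
move=> v A [<- <-]; rewrite gE eqxx u_v0 // setDv cards0 mulr0 addr0.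
by rewrite subrr.
Qed.

End GraphRays.

(** * R_G as the subring of degree zero of C *)

Section GraphRing.
Variables (K : fieldType) (n : nat) (e : rel 'I_n).
Hypothesis simple_e : simple_graph e.
Local Notation S := {mpoly K[n * n]}.
Local Notation C := {mpoly K[#|rays e|]}.
Implicit Types (u : 'X_{1..n * n}) (m : 'X_{1..#|rays e|}) (p q : S).

Let e_sym : symmetric e. Proof. by case: simple_e. Qed.
Let e_irr : irreflexive e. Proof. by case: simple_e. Qed.

Lemma mon_imageD u1 u2 :
  mon_image e (u1 + u2)%MM = (mon_image e u1 + mon_image e u2)%MM.
Proof.
apply/mnmP => i; rewrite mnmDE !mnm_sumE -big_split; apply: eq_bigr => k _ /=.
by rewrite !mulmnE mnmDE mulnDr.
Qed.

Lemma mon_image1 k : mon_image e U_(k)%MM = var_image e k.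
Proof.
apply/mnmP => i; rewrite mnm_sumE (bigD1 k) //= big1 => [|j jk].
  by rewrite mulmnE mnm1E eqxx muln1 addn0.
by rewrite mulmnE mnm1E eq_sym (negPf jk) muln0.
Qed.

(** The variable y_(i,A) occurs once in the image of x_ii and in that of exactly one of x_ij and
    x_ji, depending on whether j is in A; the same holds with i and j exchanged. *)
Lemma var_image_edge i j : e i j ->
  (var_image e (mxvec_index i i) + var_image e (mxvec_index j j) =
   var_image e (mxvec_index i j) + var_image e (mxvec_index j i))%MM.
Proof.
move=> ij; apply: mnm_at_inj => x xJ; rewrite !mnm_atD /var_image !mxvecE !mxE.
rewrite !mnm_at_of //; case: x xJ => [[v A]|[k l]].
  rewrite /= => _; rewrite !eqxx !e_irr ij [e j i]e_sym ij /=.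
  have [iE|_] := eqVneq i j; first by rewrite iE e_irr in ij.
  by rewrite eq_sym; case: eqP; case: eqP; case: (i \in A); case: (j \in A).
rewrite fray_in /= !xpair_eqE => /andP[kl ekl].
have [kE|_] := eqVneq k i; have [lE|_] := eqVneq l j;
  have [kE'|_] := eqVneq k j; have [lE'|_] := eqVneq l i => //=; subst;
  by rewrite ?eqxx ?ij 1?e_sym ?ij in kl ekl.
Qed.

Definition cox_map : S -> C :=
  mmap (@mpolyC #|rays e| K) (fun k => 'X_[var_image e k]).

HB.instance Definition _ := GRing.RMorphism.on cox_map.

Lemma cox_mapX u : cox_map 'X_[u] = 'X_[mon_image e u].
Proof.
by rewrite /cox_map mmapX /mmap1 mprodXnE.
Qed.

Lemma cox_mapE p : cox_map p = \sum_(u <- msupp p) p@_u *: 'X_[mon_image e u].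
Proof.
rewrite {1}[p]mpolyE raddf_sum; apply: eq_bigr => u _ /=.
by rewrite -mul_mpolyC rmorphM /= cox_mapX /cox_map mmapC mul_mpolyC.
Qed.

Let I : idealr S := Idealr.clone _ (@P_G K n e) _.

Lemma P_GD p q : p \in @P_G K n e -> q \in @P_G K n e -> p + q \in @P_G K n e.
Proof. exact: (@rpredD _ I). Qed.

Lemma P_GM p q : q \in @P_G K n e -> p * q \in @P_G K n e.
Proof. exact: (@idealMr _ I). Qed.

Lemma edge_binomial_in i j : e i j ->
  'X_[U_(mxvec_index i i) + U_(mxvec_index j j)] -
  'X_[U_(mxvec_index i j) + U_(mxvec_index j i)] \in @P_G K n e.
Proof.
wlog lt_ij : i j / (i < j)%N => [wlog_ij ij|ij].
  case: (ltngtP i j) => [lt_ij|lt_ji|/val_inj ijE].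
  - exact: wlog_ij.
  - by rewrite addmC [(_ + U_(mxvec_index j i))%MM]addmC; apply: wlog_ij;
      rewrite // e_sym.
  by rewrite ijE e_irr in ij.
apply/asboolP; set f := _ - _; exists [:: (1, f)];
  last by rewrite big_seq1 mul1r.
by move=> c; rewrite inE => /eqP->; exists i, j; split=> //;
  rewrite /f !mpolyXD.
Qed.

Lemma cox_map_P_G p : p \in @P_G K n e -> cox_map p = 0.
Proof.
move=> /asboolP[s sP ->]; rewrite raddf_sum big_seq big1 //= => c /sP[i [j [_
  ij ->]]].
rewrite rmorphM rmorphB !rmorphM /= /xvar !cox_mapX !mon_image1 -!mpolyXD.
by rewrite var_image_edge // subrr mulr0.
Qed.

Definition off_diag u := (\sum_(x : 'I_n * 'I_n | x.1 != x.2) expo u x.1 x.2)%N.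

Lemma off_diagD u1 u2 : off_diag (u1 + u2)%MM = (off_diag u1 + off_diag u2)%N.
Proof. by rewrite /off_diag -big_split; apply: eq_bigr => x _;
  rewrite /expo mnmDE. Qed.

Lemma off_diag1 i j : off_diag U_(mxvec_index i j) = (i != j).
Proof.
rewrite /off_diag big_mkcond (bigD1 (i, j)) //= /expo mnm1E eqxx big1 => [|x
  xij].
  by case: eqP.
case: ifP => // _; rewrite mnm1E; case: eqP => // eq_ij; case/eqP: xij.
by apply: (bij_inj (onT_bij (curry_mxvec_bij n n))); rewrite [RHS]/= eq_ij;
  case: x {eq_ij}.
Qed.

(** Rewriting x_ij x_ji as x_ii x_jj changes neither the class modulo P_G nor the image, and lowers
    [off_diag] by 2. *)
Lemma standard_reduction u : exists u0,
  [/\ standard e u0, mon_image e u0 = mon_image e u & 'X_[u] - 'X_[u0] \in @P_G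
    K n e].
Proof.
have [k] := ubnP (off_diag u); elim: k => // k IHk in u *; move=> lek.
have [|nst] := pselect (standard e u); first by exists u;
  rewrite subrr (@rpred0 _ I).
have [i [j [ij ui uj]]] : exists i j, [/\ e i j, expo u i j != 0%N & expo u j i
  != 0%N].
  apply: contrapT => none; apply: nst => i j ij.
  have [|ui] := eqVneq (expo u i j) 0%N; first by left.
  have [|uj] := eqVneq (expo u j i) 0%N; first by right.
  by case: none; exists i, j.
pose a := (U_(mxvec_index i j) + U_(mxvec_index j i))%MM.
pose b := (U_(mxvec_index i i) + U_(mxvec_index j j))%MM.
have neq_ij : i != j by apply: contraTneq ij => ->; rewrite e_irr.
have neq_idx : mxvec_index i j != mxvec_index j i.
  apply: contraNneq neq_ij => /(bij_inj (onT_bij (curry_mxvec_bij n n)) (x1 :=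
    (i, j)) (x2 := (j, i))).
  by case=> ->.
have au : (a <= u)%MM.
  apply/mnm_lepP => l; rewrite mnmDE !mnm1E.
  have [<-|_] := eqVneq (mxvec_index i j) l.
    by rewrite eq_sym (negPf neq_idx) addn0 lt0n.
  by have [<-|//] := eqVneq (mxvec_index j i) l; rewrite lt0n.
have uE := submK au; set w := (u - a)%MM in uE.
have [|u0 [st0 im0 eq0]] := IHk (w + b)%MM.
  move: lek; rewrite -uE !off_diagD !off_diag1 !eqxx neq_ij eq_sym neq_ij.
  by rewrite /= !addn0 addn1 addnS; lia.
exists u0; split=> //; rewrite ?im0 -uE.
  by rewrite !mon_imageD !mon_image1 var_image_edge.
have -> : 'X_[w + a] - 'X_[u0] = - 'X_[w] * ('X_[b] - 'X_[a]) + ('X_[w + b] -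
  'X_[u0]) :> S.
  by rewrite mulNr mulrBr -!mpolyXD opprB addrA subrK.
by apply: P_GD => //; apply: P_GM; apply: edge_binomial_in.
Qed.

Lemma standard_preimage_congr u :
  'X_[u] - 'X_[standard_preimage (mon_image e u)] \in @P_G K n e.
Proof.
have [u0 [st0 im0]] := standard_reduction u.
suff -> : u0 = standard_preimage (mon_image e u) by [].
apply: (standard_inj simple_e) => //; first exact: standard_preimageP.
by rewrite standard_preimageK // weight_image.
Qed.

Lemma mcoeff_cox_map p m :
  (cox_map p)@_m = \sum_(u <- msupp p | mon_image e u == m) p@_u.
Proof.
rewrite cox_mapE raddf_sum [RHS]big_mkcond /=; apply: eq_bigr => u _.
by rewrite mcoeffZ mcoeffX; case: eqP; rewrite ?mulr1 ?mulr0.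
Qed.

(** Modulo P_G each monomial of [p] may be replaced by the standard one with the same image. The
    coefficients then add up over the fibres of [mon_image], that is, to the coefficients of
    [cox_map p], which are zero. *)
Lemma cox_map_kernel p : cox_map p = 0 -> p \in @P_G K n e.
Proof.
move=> p0.
have : \sum_(u <- msupp p) p@_u *: 'X_[standard_preimage (mon_image e u)] = 0
  :> S.
  apply/mpolyP => u0; rewrite mcoeff0 raddf_sum /=.
  pose m := mon_image e u0.
  have [u0E|u0N] := eqVneq u0 (standard_preimage m).
    transitivity (cox_map p)@_m; last by rewrite p0 mcoeff0.
    rewrite mcoeff_cox_map [RHS]big_mkcond; apply: eq_bigr => u _.
    rewrite mcoeffZ mcoeffX; case: eqP => [uE|]; case: eqP => [um|] //=.
    - by rewrite mulr1.
    - by case; rewrite /m -uE standard_preimageK // weight_image.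
    - by case; rewrite um -u0E.
    by rewrite mulr0.
  rewrite big1 // => u _; rewrite mcoeffZ mcoeffX; case: eqP => [uE|];
    last by rewrite mulr0.
  case/eqP: u0N; rewrite /m -uE; congr standard_preimage.
  by rewrite standard_preimageK // weight_image.
move=> q0; rewrite -[p]subr0 -q0 {1}[p]mpolyE -sumrB.
rewrite big_seq; elim/big_ind: _ => [|f g|u _].
- exact: (@rpred0 _ I).
- exact: P_GD.
rewrite -scalerBr -mul_mpolyC; apply: P_GM.
exact: standard_preimage_congr.
Qed.

Lemma cox_map_weight p : {in msupp (cox_map p), forall m, weight m = 0}.
Proof.
move=> m; rewrite cox_mapE => /msupp_sum_le /flattenP[s /mapP[u _ ->]].
by move=> /msuppZ_le; rewrite msuppX inE => /eqP->; apply: weight_image.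
Qed.

Lemma cox_map_onto (f : C) : {in msupp f, forall m, weight m = 0} ->
  exists p, cox_map p = f.
Proof.
move=> f0; exists (\sum_(m <- msupp f) f@_m *: 'X_[standard_preimage m]).
rewrite raddf_sum [RHS]mpolyE big_seq [RHS]big_seq;
  apply: eq_bigr => m /f0 m0 /=.
rewrite -mul_mpolyC rmorphM /= cox_mapX standard_preimageK //.
by rewrite /cox_map mmapC mul_mpolyC.
Qed.

Definition cox_embedding (x : R_G K e) : C := cox_map (repr (x : {ideal_quot
  I})).

Lemma cox_embedding_pi p : cox_embedding (\pi_({ideal_quot I}) p)%qT = cox_map
  p.
Proof.
apply/eqP; rewrite -subr_eq0 -rmorphB /=; apply/eqP; apply: cox_map_P_G.
by rewrite -[_ \in _]/(_ \in I) Quotient.idealrBE reprK.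
Qed.

Fact cox_embedding_is_additive : zmod_morphism cox_embedding.
Proof.
move=> x y; rewrite -[x](@reprK _ {ideal_quot I}) -[y](@reprK _ {ideal_quot I}).
by rewrite -raddfB !cox_embedding_pi raddfB.
Qed.

Fact cox_embedding_is_multiplicative : monoid_morphism cox_embedding.
Proof.
split=> [|x y].
  have -> : 1 = (\pi_({ideal_quot I}) 1)%qT :> R_G K e by rewrite rmorph1.
  by rewrite cox_embedding_pi rmorph1.
rewrite -[x](@reprK _ {ideal_quot I}) -[y](@reprK _ {ideal_quot I}).
by rewrite -rmorphM !cox_embedding_pi rmorphM.
Qed.

HB.instance Definition _ := GRing.isZmodMorphism.Build (R_G K e) C cox_embedding
  cox_embedding_is_additive.
HB.instance Definition _ := GRing.isMonoidMorphism.Build (R_G K e) C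
  cox_embedding
  cox_embedding_is_multiplicative.

Lemma cox_embedding_inj : injective cox_embedding.
Proof.
move=> x y xy; apply/eqP; rewrite -subr_eq0; apply/eqP.
have : cox_embedding (x - y) = 0 by rewrite raddfB /= xy subrr.
move: (x - y) => z z0; rewrite -[z](@reprK _ {ideal_quot I}).
rewrite -(raddf0 (\pi_({ideal_quot I}))%qT); apply/eqP.
by rewrite -Quotient.idealrBE subr0; apply: cox_map_kernel.
Qed.

Lemma has_rank_Cl_R_G : (0 < n)%N -> has_rank (Cl (R_G K e)) #|essential e|.
Proof.
move=> n0.
apply: (@has_rank_Cl_degree K _ _ (@weight n e) _ _ _ (R_G K e) cox_embedding).
- exact: weightD.
(* Surjectivity of the weight is read off [weight_preimage] at any ray; a vertex with the empty set
   provides one. *)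
- have r0 : inl (Ordinal n0, set0) \in rays e by rewrite vray_in sub0set.
  by move=> d; have [m _ mE] := weight_preimage simple_e (enum_rank_in r0 (inl
    (Ordinal n0, set0))) d; exists m.
- exact: weight_preimage.
- exact: cox_embedding_inj.
- by move=> x; apply: cox_map_weight.
- move=> f /cox_map_onto[p pE]; exists (\pi_({ideal_quot I}) p)%qT.
  by rewrite -pE -cox_embedding_pi.
Qed.

End GraphRing.

Local Close Scope ring_scope.

(** * Counting vertices and edges *)

Section EdgeCounting.
Variables (n : nat) (e : rel 'I_n).
Hypothesis simple_e : simple_graph e.
Implicit Types (u v w x y : 'I_n) (A : {set 'I_n}).

Let e_sym : symmetric e. Proof. by case: simple_e. Qed.
Let e_irr : irreflexive e. Proof. by case: simple_e. Qed.
Local Notation nbr := (nbr e).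
Local Notation m := (num_edges e).

Definition edges : {set 'I_n * 'I_n} :=
  [set ij : 'I_n * 'I_n | (ij.1 < ij.2) && e ij.1 ij.2].

Definition edge v w : 'I_n * 'I_n := if v < w then (v, w) else (w, v).

Lemma edgeC v w : edge v w = edge w v.
Proof. by rewrite /edge; case: ltngtP => // /val_inj->. Qed.

Lemma edge_in v w : (edge v w \in edges) = e v w.
Proof.
rewrite /edge inE; case: (ltngtP v w) => [vw|wv|/val_inj->] /=.
- by rewrite vw.
- by rewrite wv e_sym.
by rewrite ltnn e_irr.
Qed.

Lemma edgeP x y v w : edge x y = edge v w -> (x = v /\ y = w) \/ (x = w /\ y =
  v).
Proof. by rewrite /edge; case: ifP; case: ifP => _ _ [-> ->]; auto. Qed.

Lemma edges_edge (p : 'I_n * 'I_n) : p \in edges -> p = edge p.1 p.2 /\ e p.1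
  p.2.
Proof. by case: p => v w; rewrite inE /edge /= => /andP[-> ->]. Qed.

Lemma edge_inj v : injective (edge v).
Proof. by move=> w w' /edgeP[[]//|[-> ->]]. Qed.

Lemma sum_degrees : \sum_v #|nbr v| = 2 * m.
Proof.
pose R := [set p : 'I_n * 'I_n | e p.1 p.2].
have -> : \sum_v #|nbr v| = #|R|.
  rewrite -sum1_card (eq_bigl (fun p => e p.1 p.2)) => [|p];
    last by rewrite inE.
  rewrite -(pair_big_dep xpredT e (fun _ _ => 1)) /=; apply: eq_bigr => v _.
  by rewrite sum1_card; apply: eq_card => w; rewrite !inE.
rewrite -(cardsID edges R) mul2n -addnn; congr (_ + _).
  by apply: eq_card => p; rewrite !inE andbC -andbA andbb.
pose swap (p : 'I_n * 'I_n) := (p.2, p.1).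
rewrite -[RHS](card_imset (mem edges) (can_inj (_ : cancel swap swap)));
  last by case.
apply: eq_card => -[v w]; rewrite !inE /=;
  apply/andP/imsetP => [[vw evw]|[[x y]]].
  exists (w, v) => //; rewrite inE /= e_sym evw andbT.
  by move: vw; rewrite evw andbT; case: ltngtP => // /val_inj vE;
    rewrite vE e_irr in evw.
by rewrite inE /= => /andP[xy exy] [-> ->];
  rewrite e_sym exy andbT -leqNgt ltnW.
Qed.

Definition branches : {set 'I_n * {set 'I_n}} :=
  [set q : _ * {set _} | (q.2 \subset nbr q.1) && (1 < #|q.2|)].

(** The essential pairs with a singleton are the (v, {w}) with w < v, one for each edge. *)
Lemma card_essential : #|essential e| = #|branches| + m.
Proof.
pose E1 := [set ((p.2, [set p.1]) : 'I_n * {set 'I_n}) | p in edges].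
have -> : m = #|E1|.
  by rewrite card_imset // => -[x y] [x' y'] [/= -> /set1_inj->].
rewrite -(cardsID branches); congr (_ + _).
  apply: eq_card => -[v A]; rewrite !inE /=.
  have [Av|//] := boolP (A \subset nbr v).
  have [A2|] := boolP (1 < #|A|); last by rewrite !andbF.
  rewrite -card_gt0 (ltnW A2) andbT /=.
  rewrite !andbT; apply/negP => /existsP[w /andP[/eqP AE _]].
  by rewrite AE cards1 in A2.
apply: eq_card => -[v A]; rewrite !inE /=; apply/andP/imsetP => [[]|[[x y]]].
  rewrite negb_and -leqNgt => A2 /and3P[Av A0 noA].
  rewrite Av /= leq_eqVlt ltnS leqn0 cards_eq0 (negPf A0) orbF in A2.
  have /cards1P[w AE] := A2; exists (w, v); last by rewrite AE.
  have vw : e v w by rewrite AE nbr_sub1 in Av.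
  rewrite inE /= e_sym vw andbT ltnNge; apply: contra noA => vw_le.
  apply/existsP; exists w; rewrite AE eqxx /= ltn_neqAle vw_le andbT.
  by apply: contraTneq vw => /val_inj->; rewrite e_irr.
rewrite inE /= => /andP[xy exy] [-> ->]; split.
  by rewrite cards1 andbF.
rewrite nbr_sub1 e_sym exy /=; apply/andP; split.
  by rewrite -card_gt0 cards1.
apply/negP => /existsP[w /andP[/eqP/set1_inj <-]].
by rewrite ltnNge ltnW.
Qed.

(* For [1 < #|A|] the set of edges from [v] to [A] determines [v], two distinct
   edges having at most one common vertex. *)
Definition star_edges (q : 'I_n * {set 'I_n}) := [set edge q.1 w | w in q.2].

Lemma star_edges_inj : {in branches &, injective star_edges}.
Proof.
move=> [v A] [v' A']; rewrite !inE /= => /andP[Av A1] /andP[A'v _] eqAA'.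
have v'E : v' = v.
  have [w1 [w2 [w1A w2A w12]]] := card_gt1P A1.
  have edge_in' w : w \in A -> exists2 w', w' \in A' & edge v w = edge v' w'.
    move=> wA; have : edge v w \in star_edges (v, A) by apply: imset_f.
    by rewrite eqAA' => /imsetP[w' ? ?]; exists w'.
  have [w1' _ /edgeP[[]//|[v1 v1']]] := edge_in' w1 w1A.
  have [w2' _ /edgeP[[]//|[v2 v2']]] := edge_in' w2 w2A.
  by rewrite v1' v2' eqxx in w12.
move: eqAA'; rewrite v'E; rewrite /star_edges /= => /(imset_inj (@edge_inj
  v))->.
by [].
Qed.

Definition edge_sets : {set {set 'I_n * 'I_n}} :=
  [set F : {set _} | (F \subset edges) && (1 < #|F|)].

Lemma star_edges_sub : [set star_edges q | q in branches] \subset edge_sets.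
Proof.
apply/subsetP => F /imsetP[[v A]]; rewrite inE /= => /andP[Av A1] ->.
rewrite inE card_imset //=; last exact: edge_inj.
rewrite A1 andbT; apply/subsetP => _ /imsetP[w wA ->]; rewrite edge_in.
by have := subsetP Av w wA; rewrite inE.
Qed.

Lemma card_edge_sets : #|edge_sets| + m + 1 = 2 ^ m.
Proof.
rewrite -[m in RHS]/(#|edges|) -card_powerset.
rewrite -(cardsID edge_sets (powerset _)) -addnA.
congr (_ + _).
  by apply: eq_card => F; rewrite !inE; case: (F \subset edges).
have -> : powerset edges :\: edge_sets =
    [set F : {set _} | F \subset edges & #|F| == 1] :|:
    [set F : {set _} | F \subset edges & #|F| == 0].
  apply/setP => F; rewrite !inE; case: (F \subset edges) => //=.
  by case: #|F| => [|[|]].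
rewrite cardsU disjoint_setI0 ?cards0 ?subn0.
  by rewrite !cards_draws bin0 bin1.
rewrite -setI_eq0; apply/eqP/setP => F; rewrite !inE.
by case: (#|F|) => [|[|k]]; rewrite ?andbF.
Qed.

Lemma essential_le : #|essential e| <= 2 ^ m - 1.
Proof.
rewrite card_essential -card_edge_sets addnK leq_add2r.
rewrite -(card_in_imset star_edges_inj).
exact: subset_leq_card star_edges_sub.
Qed.

Lemma essential_max : #|essential e| = 2 ^ m - 1 ->
  [set star_edges q | q in branches] = edge_sets.
Proof.
rewrite card_essential -card_edge_sets addnK => /addIn cardE.
apply/eqP; rewrite eqEcard star_edges_sub.
by rewrite (card_in_imset star_edges_inj) cardE leqnn.
Qed.

Definition center v := forall x y, e x y -> x = v \/ y = v.

(** When all edges meet [v], every set of at least two edges is a star at [v], on the set of the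
    other ends. *)
Lemma center_essential v : center v -> #|essential e| = 2 ^ m - 1.
Proof.
move=> vC; rewrite card_essential -card_edge_sets addnK.
rewrite -(card_in_imset star_edges_inj); congr (_ + _).
apply/eqP; rewrite eqn_leq subset_leq_card ?star_edges_sub //=.
apply/subset_leq_card/subsetP => F; rewrite inE => /andP[FE F1].
have FE' : F = star_edges (v, [set w | edge v w \in F]).
  apply/setP => p; apply/idP/imsetP => [pF|[w]]; last by rewrite inE => + ->.
  have [pE /vC[] pv] := edges_edge (subsetP FE p pF).
    by exists p.2; rewrite ?inE /= -pv -pE.
  by exists p.1; rewrite ?inE /= -pv edgeC -pE.
apply/imsetP; exists (v, [set w | edge v w \in F]) => //.
rewrite inE /=; apply/andP; split.
  apply/subsetP => w; rewrite !inE => /(subsetP FE); by rewrite edge_in.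
by rewrite FE' card_imset // in F1; exact: edge_inj.
Qed.

(** At the maximum every set of at least two edges is a star; for [1 < m] this applies to the set of
    all edges. *)
Lemma essential_center : 1 < m -> #|essential e| = 2 ^ m - 1 -> exists v,
  center v.
Proof.
move=> m1 /essential_max imE.
have : edges \in [set star_edges q | q in branches] by rewrite imE inE subxx.
move=> /imsetP[[v A] _ edgesE]; exists v => x y.
rewrite -edge_in edgesE => /imsetP[w _ /edgeP[[]|[]]]; auto.
Qed.

(** The inessential pairs are the n pairs with an empty set and the m pairs (v, {w}) with v < w, one
    for each edge. *)
Lemma card_rays_sum : #|essential e| + n + m = \sum_v 2 ^ #|nbr v|.
Proof.
pose V := [set q : 'I_n * {set 'I_n} | q.2 \subset nbr q.1].
have -> : \sum_v 2 ^ #|nbr v| = #|V|.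
  rewrite -[RHS]sum1_card (eq_bigl (fun q : 'I_n * {set 'I_n} => q.2 \subset
    nbr q.1)) => [|q]; last by rewrite inE.
  rewrite -(pair_big_dep xpredT (fun v A => A \subset nbr v) (fun _ _ => 1)) /=.
  apply: eq_bigr => v _; rewrite sum1_card -card_powerset.
  by apply: eq_card => A; rewrite !inE.
rewrite -(cardsID (essential e) V) -addnA; congr (_ + _).
  by apply: eq_card => -[v A]; rewrite !inE /=; case: (A \subset nbr v);
    rewrite ?andbF ?andbT.
pose Z := [set ((v, set0) : 'I_n * {set 'I_n}) | v : 'I_n].
pose E1 := [set ((p.1, [set p.2]) : 'I_n * {set 'I_n}) | p in edges].
have -> : m = #|E1|.
  by rewrite card_imset // => -[x y] [x' y'] [/= -> /set1_inj->].
have nE : #|Z| = n by rewrite card_imset ?card_ord // => x y [].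
have ZE1 : [disjoint Z & E1].
  rewrite -setI_eq0; apply/eqP/setP => -[v A]; rewrite !inE; apply/andP => -[].
  move=> /imsetP[w _ [_ ->]] /imsetP[[x y] _ [_ /setP/(_ y)]].
  by rewrite !inE eqxx.
transitivity #|Z :|: E1|; first by rewrite cardsU (disjoint_setI0 ZE1) cards0
  subn0 nE.
apply: eq_card => -[v A]; rewrite !inE /=; apply/orP/andP => [[]|[]].
- by move=> /imsetP[w _ [-> ->]]; rewrite sub0set eqxx /=.
- move=> /imsetP[[x y]]; rewrite inE /= => /andP[xy exy] [-> ->].
  rewrite nbr_sub1 exy /= negb_and !negbK; split=> //; apply/orP; right.
  by apply/existsP; exists y; rewrite eqxx.
move=> + Av; rewrite Av /= negb_and !negbK => /orP[/eqP->|].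
  by left; apply/imsetP; exists v.
move=> /existsP[w /andP[/eqP AE vw]]; right; apply/imsetP; exists (v, w).
  by rewrite inE /= vw -(nbr_sub1 e) -AE.
by rewrite AE.
Qed.

Lemma leq_double_exp2 d : 2 * d <= 2 ^ d.
Proof. by elim: d => // d IHd; rewrite expnS mulnS; case: d IHd => // d;
  lia. Qed.

Lemma essential_ge : n <= m.+1 -> 2 * m - 1 <= #|essential e|.
Proof.
move=> nm; have := card_rays_sum; have := sum_degrees.
have : \sum_v 2 * #|nbr v| <= \sum_v 2 ^ #|nbr v|.
  by apply: leq_sum => v _; exact: leq_double_exp2.
by rewrite -big_distrr /=; lia.
Qed.

(** The sum of the 2^(deg v) is at least twice the degree sum, that is 4m. Rank 2m - 1 forces n to
    be at least m + 1, hence equal to it, and then equality in 2d <= 2^d at every vertex, which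
    means d = 1 or d = 2. *)
Lemma essential_minP : n <= m.+1 -> 0 < m -> #|essential e| = 2 * m - 1 <->
  n = m.+1 /\ forall v, 0 < #|nbr v| <= 2.
Proof.
move=> nm m0; have rE := card_rays_sum; have dE := sum_degrees.
have degP d : (2 * d == 2 ^ d) = (0 < d <= 2).
  case: d => [|[|[|d]]] //; apply/negbTE; rewrite neq_ltn; apply/orP; left.
  by elim: d => // d IHd; rewrite expnS; lia.
have le2 v : 2 * #|nbr v| <= 2 ^ #|nbr v| by exact: leq_double_exp2.
have sum2 : \sum_v 2 * #|nbr v| = 4 * m by rewrite -big_distrr /= dE; lia.
split=> [r_min|[nE deg2]].
  have : \sum_v 2 * #|nbr v| <= \sum_v 2 ^ #|nbr v| by apply: leq_sum.
  rewrite sum2 -rE => le_sum; have nE : n = m.+1 by lia.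
  split=> // v; rewrite -degP.
  have := leqif_sum (I := 'I_n) (P := xpredT) (fun v _ => leqif_eq (le2 v)).
  by case=> _; rewrite sum2 -rE (_ : 4 * m == _) => [/esym/forallP/(_ v)//|];
    lia.
have : \sum_v 2 * #|nbr v| = \sum_v 2 ^ #|nbr v|.
  by apply: eq_bigr => v _; apply/eqP; rewrite degP.
by rewrite sum2 -rE; lia.
Qed.

End EdgeCounting.

(** * Distance from a root in a connected graph *)

Section Distance.
Variables (n : nat) (e : rel 'I_n).
Hypothesis simple_e : simple_graph e.
Hypothesis connected_e : connected_graph e.
Variable root : 'I_n.
Implicit Types (u v w x y : 'I_n).
Local Notation nbr := (nbr e).
Local Notation m := (num_edges e).

Let e_sym : symmetric e. Proof. by case: simple_e. Qed.
Let e_irr : irreflexive e. Proof. by case: simple_e. Qed.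

Definition reachable_in v k :=
  `[< exists p, [/\ size p = k, path e root p & last root p = v] >].

Fact reachable_in_lt v : exists2 k, k < n & reachable_in v k.
Proof.
have [_ /(_ root v) /connectP[p ep ->]] := connected_e.
have [q eq uq _] := shortenP ep.
exists (size q); last by apply/asboolP; exists q.
rewrite -[X in _ < X](card_ord n) -[_ < _]/(size (root :: q) <= _).
by rewrite -(card_uniqP uq) max_card.
Qed.

Fact reachable_in_some v : exists k, reachable_in v k.
Proof. by have [k _ vk] := reachable_in_lt v; exists k. Qed.

Definition dist v := ex_minn (reachable_in_some v).

Lemma dist_path v : exists p, [/\ size p = dist v, path e root p & last root p
  = v].
Proof. by rewrite /dist; case: ex_minnP => k /asboolP. Qed.

Lemma dist_le v p : path e root p -> last root p = v -> dist v <= size p.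
Proof.
move=> ep pv; rewrite /dist; case: ex_minnP => k _; apply.
by apply/asboolP; exists p.
Qed.

Lemma dist_lt v : dist v < n.
Proof.
have [k kn vk] := reachable_in_lt v; apply: leq_ltn_trans kn.
by rewrite /dist; case: ex_minnP => j _; apply.
Qed.

Lemma dist_root : dist root = 0.
Proof. by apply/eqP; rewrite -leqn0; exact: (@dist_le _ [::]). Qed.

Lemma dist_eq0 v : dist v = 0 -> v = root.
Proof.
move=> v0; have [p [pv _ pE]] := dist_path v.
by rewrite v0 in pv; rewrite -pE; case: p pv {pE}.
Qed.

Lemma dist_edge u v : e u v -> dist v <= (dist u).+1.
Proof.
move=> uv; have [p [<- ep pu]] := dist_path u; rewrite -(size_rcons p v).
by apply: dist_le; rewrite ?last_rcons // rcons_path ep pu.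
Qed.

Lemma dist_parent v : v != root -> exists2 u, e u v & dist v = (dist u).+1.
Proof.
have [p [pv ep lp]] := dist_path v => v_root.
case/lastP: p pv ep lp => [|p w]; first by move=> _ _ vE;
  rewrite -vE eqxx in v_root.
rewrite size_rcons rcons_path last_rcons => pv /andP[ep pw] wv.
exists (last root p); first by rewrite -wv.
apply/eqP; rewrite eqn_leq -{2}pv ltnS (dist_le ep) // andbT.
by apply: dist_edge; rewrite -wv.
Qed.



(** Each vertex other than the root is joined to a parent one step closer to the root; this edge
    determines the vertex, as its farther end. *)
Lemma card_vertices_le : n <= m.+1.
Proof.
pose parent v := odflt root [pick u | e u v && (dist v == (dist u).+1)].
have parentP v : v != root -> e (parent v) v /\ dist v = (dist (parent v)).+1.
  move=> /dist_parent[u uv dv]; rewrite /parent;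
    case: pickP => [w /andP[-> /eqP]//|/(_ u)].
  by rewrite uv dv eqxx.
have par_inj : {in [set~ root] &, injective (fun v => edge (parent v) v)}.
  move=> v w; rewrite !inE => vr wr /edgeP[[]//|[pv vp]].
  have [_ dv] := parentP v vr; have [_ dw] := parentP w wr.
  by move: dv dw; rewrite pv -vp; lia.
have : [set edge (parent v) v | v in [set~ root]] \subset edges e.
  apply/subsetP => p /imsetP[v]; rewrite in_setC1 => vr ->.
  by rewrite edge_in //; have [] := parentP v vr.
move=> /subset_leq_card; rewrite card_in_imset // cardsC1 card_ord.
by rewrite -[#|edges e|]/m; lia.
Qed.

(** By induction, two vertices at distance k + 1 have the same parent. If they were distinct, this
    parent would have two neighbours if it is the root, and otherwise three, its own parent
    included. *)
Lemma dist_inj : (forall v, #|nbr v| <= 2) -> #|nbr root| <= 1 -> injective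
  dist.
Proof.
move=> deg2 deg1.
suff inj_k k v w : dist v = k -> dist w = k -> v = w by move=> v w vw;
  apply: (inj_k (dist w)).
elim: k v w => [|k IHk] v w dv dw.
  by rewrite (dist_eq0 dv) (dist_eq0 dw).
have nroot x : dist x = k.+1 -> x != root.
  by move=> dx; apply/eqP => xr; rewrite xr dist_root in dx.
have [u uv] := dist_parent (nroot v dv); rewrite dv => -[/esym du].
have [u' u'w] := dist_parent (nroot w dw); rewrite dw => -[/esym du'].
rewrite (IHk _ _ du' du) {u' du'} in u'w.
have [u_root|u_root] := eqVneq u root.
  apply: contraTeq deg1 => vw; rewrite -ltnNge -u_root.
  by apply/card_gt1P; exists v, w; rewrite !inE.
have [t tu dt] := dist_parent u_root.
apply: contraTeq (deg2 u) => vw; rewrite -ltnNge.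
apply/card_gt2P; exists v, w, t; rewrite !inE uv u'w e_sym tu.
split=> //; split=> //; apply/eqP => E; move: dv dw dt du; rewrite ?E; lia.
Qed.

End Distance.

(** * Recognizing the line and the star *)

Section LineAndStar.
Variables (n : nat) (e : rel 'I_n).
Hypothesis simple_e : simple_graph e.
Hypothesis connected_e : connected_graph e.
Implicit Types (u v w x y : 'I_n).
Local Notation nbr := (nbr e).
Local Notation m := (num_edges e).

Let e_sym : symmetric e. Proof. by case: simple_e. Qed.
Let e_irr : irreflexive e. Proof. by case: simple_e. Qed.
Let n_gt0 : 0 < n. Proof. by case: connected_e. Qed.

Lemma graph_iso_card n' (e' : rel 'I_n') : graph_iso e e' -> n = n'.
Proof. by move=> [f /bij_eq_card + _]; rewrite !card_ord. Qed.

Lemma degree_gt0 v : 1 < n -> 0 < #|nbr v|.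
Proof.
move=> n1; have [w wv] : exists w, w != v.
  have : 0 < #|[set~ v]| by rewrite cardsC1 card_ord; lia.
  by case/card_gt0P => w; rewrite in_setC1; exists w.
have vw : v != w by rewrite eq_sym.
have [u uv _] := dist_parent connected_e vw.
by apply/card_gt0P; exists u; rewrite inE e_sym.
Qed.

(** The degree sum 2m is less than 2n, so some vertex has degree at most 1. The distance from it is
    injective with values at most m, and is the isomorphism. *)
Lemma line_graph_isoP : n = m.+1 /\ (forall v, #|nbr v| <= 2) <->
  graph_iso e (line_graph m).
Proof.
split=> [[nE deg2]|iso]; last first.
  have nE := graph_iso_card iso; split=> // v; have [f f_bij fe] := iso.
  have f_inj := bij_inj f_bij; rewrite -(card_imset _ f_inj).
  (* At an end of the line one of the two is a spurious value, harmless for an upper bound. *)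
  suff sub : f @: nbr v \subset [set inord (f v).-1; inord (f v).+1].
    by apply: leq_trans (subset_leq_card sub) _; rewrite cards2; case: (_ != _).
  apply/subsetP => y /imsetP[w]; rewrite inE -fe /line_graph => fvw ->.
  rewrite !inE; case/orP: fvw => /eqP.
    by move=> ->; rewrite inord_val eqxx orbT.
  by move=> <-; rewrite /= inord_val eqxx.
have [root root1] : exists root, #|nbr root| <= 1.
  apply: contrapT => none; have : \sum_(v < n) 2 <= \sum_v #|nbr v|.
    by apply: leq_sum => v _; rewrite ltnNge; apply/negP => v1; apply: none;
      exists v.
  by rewrite sum_nat_const card_ord sum_degrees //; move: nE; lia.
pose d := dist connected_e root.
have d_inj : injective d by apply: dist_inj.
have dm v : d v < m.+1 := leq_trans (dist_lt connected_e root v) (eq_leq nE).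
pose f v : 'I_m.+1 := inord (d v).
have f_inj : injective f.
  by move=> v w /(congr1 val); rewrite /= !inordK // => /d_inj.
exists f; first by apply: inj_card_bij => //; rewrite !card_ord -nE.
have step v w : d w = (d v).+1 -> e v w.
  move=> dw; have wr : w != root.
    by apply/eqP => wr; move: dw; rewrite /d wr dist_root.
  have [u uw du] := dist_parent connected_e wr.
  by rewrite -/d dw in du; case: du => /d_inj->.
move=> v w; rewrite /line_graph /= !inordK //;
  apply/orP/idP => [[/eqP dvw|/eqP dwv]|vw].
- exact: step.
- by rewrite e_sym; apply: step.
have wv : e w v by rewrite e_sym.
have := dist_edge connected_e root vw; have := dist_edge connected_e root wv.
rewrite -!/(d _); have : d v != d w.
  by rewrite (inj_eq d_inj); apply: contraTneq vw => ->; rewrite e_irr.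
lia.
Qed.

(** By connectedness any other vertex lies on an edge, whose other end must be [v]; thus the degree
    of [v] is both n - 1 and m. *)
Lemma center_star v : center e v -> n = m.+1 /\ forall w, w != v -> e v w.
Proof.
move=> vC; have star w : w != v -> e v w.
  move=> wv; have [u uw _] := dist_parent connected_e wv.
  by have [uv|wv'] := vC u w uw; [rewrite -uv | rewrite wv' eqxx in wv].
split=> //.
have nbrE : nbr v = [set~ v].
  apply/setP => w; rewrite !inE; apply/idP/idP => [vw|/star//].
  by apply: contraTneq vw => ->; rewrite e_irr.
have -> : m = #|nbr v|.
  rewrite -(card_imset _ (@edge_inj n v)); apply: eq_card => p.
  apply/idP/imsetP => [pE|[w]]; last first.
    by move=> + ->; rewrite [w \in _]inE => vw; have := edge_in simple_e v w;
      rewrite vw.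
  have [pEE e12] := edges_edge pE; have [p1|p2] := vC _ _ e12.
    by exists p.2; rewrite -p1 ?inE.
  by exists p.1; rewrite -p2 ?inE 1?e_sym // edgeC.
by rewrite nbrE cardsC1 card_ord; lia.
Qed.

Lemma star_graph_isoP : (exists v, center e v) <-> graph_iso e (star_graph m).
Proof.
split=> [[v vC]|iso]; last first.
  have [f [g fK gK] fe] := iso; exists (g ord0) => x y; rewrite -fe /star_graph.
  by case/andP => _ /orP[] /eqP E; [left | right]; rewrite -E fK.
have [nE star] := center_star vC.
pose h : 'I_n -> 'I_m.+1 := cast_ord nE.
pose f w := tperm (h v) ord0 (h w).
have f_inj : injective f by move=> x y /perm_inj/cast_ord_inj.
have fv x : (f x == ord0) = (x == v).
  by rewrite -(inj_eq f_inj x v) /f tpermL.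
exists f; first by apply: inj_card_bij => //; rewrite !card_ord -nE.
move=> x y; rewrite /star_graph !fv (inj_eq f_inj).
apply/andP/idP => [[xy /orP[] /eqP E]|xy].
- by rewrite E; apply: star; rewrite -E eq_sym.
- by rewrite E e_sym; apply: star; rewrite -E.
split; first by apply: contraTneq xy => ->; rewrite e_irr.
by apply/orP; case: (vC x y xy) => ->; [left|right].
Qed.

Lemma center_of_le1 : m <= 1 -> exists v, center e v.
Proof.
move=> m1; have [E0|[p pE]] := set_0Vmem (edges e).
  by exists (Ordinal n_gt0) => x y; rewrite -edge_in // E0 inE.
exists p.1 => x y; rewrite -edge_in // => xyE.
have xyp := card_le1_eqP m1 _ _ xyE pE; have [pEE _] := edges_edge pE.
by case/edgeP: (etrans (esym xyp) pEE) => -[]; [left | right].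
Qed.

Lemma essential_star : #|essential e| = 2 ^ m - 1 <-> graph_iso e (star_graph
  m).
Proof.
rewrite -star_graph_isoP; split=> [r_max|[v]]; last exact: center_essential.
by case: (leqP m 1) => [|m1]; [exact: center_of_le1 | exact: essential_center].
Qed.

Lemma essential_line : #|essential e| = 2 * m - 1 <-> graph_iso e (line_graph
  m).
Proof.
have nm := card_vertices_le simple_e connected_e (Ordinal n_gt0).
(* For [m = 0] the graph is a single vertex and both sides hold. The case is apart because the
   degree is then 0, outside the range in [essential_minP]. *)
rewrite -line_graph_isoP; have [m0|m_gt0] := posnP m.
  have r0 := essential_le simple_e; split=> _; last first.
    by apply/eqP; move: r0; rewrite m0 leqn0.
  have nE : n = m.+1 by apply/eqP; rewrite eqn_leq nm m0.
  split=> // v; apply: leq_trans (max_card _) _; rewrite card_ord.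
  by apply: leq_trans nm _; rewrite m0.
rewrite essential_minP //; split=> -[nE deg]; split=> // v.
  by case/andP: (deg v).
by rewrite deg andbT degree_gt0 //; move: nE; lia.
Qed.

End LineAndStar.

(* Subtraction is truncated: it only matters for m = 0, where G is a single
   vertex, Cl (R_G) = 0 and the bound 2 * m - 1 reads 0. *)
Theorem proposition2p3 (K : fieldType) (n m : nat) (e : rel 'I_n)
  (simple_e : simple_graph e) (connected_e : connected_graph e)
  (edges_e : num_edges e = m) :
  exists r : nat,
    [/\ has_rank (Cl (R_G K e)) r,
        (2 * m - 1 <= r <= 2 ^ m - 1)%N,
        r = (2 * m - 1)%N <-> graph_iso e (line_graph m) &
        r = (2 ^ m - 1)%N <-> graph_iso e (star_graph m)].
Proof.
have n_gt0 : (0 < n)%N by case: connected_e.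
exists #|essential e|; rewrite -edges_e; split.
- exact: has_rank_Cl_R_G.
- rewrite essential_ge ?essential_le //.
  exact: card_vertices_le simple_e connected_e (Ordinal n_gt0).
- exact: essential_line.
- exact: essential_star.
Qed.
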